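(* For every integer $d\ge 3$ there exists a convex body $K\subset\mathbb R^d$ such that $$\Delta(K)>\theta(K).$$
   Context: For a convex body $K\subset\mathbb R^d$ (compact convex set with nonempty interior), $\Delta(K)=\mathbb E|X_1-X_2|$ where $X_1,X_2$ are independent and distributed according to normalized Lebesgue measure on $K$, and $\theta(K)=\mathbb E|B_1-B_2|$ where $B_1,B_2$ are independent and distributed according to normalized surface measure ($(d-1)$-dimensional Hausdorff measure) on $\partial K$. $|\cdot|$ is the Euclidean norm. *)

(* Defs.v *)
From HB Require Import structures.
From mathcomp Require Import all_boot all_order all_algebra.
From mathcomp Require Import all_classical all_reals all_analysis.
From mathcomp Require Import measurable_realfun lra.

Set Implicit Arguments.
Unset Strict Implicit.
Unset Printing Implicit Defensive.

Import Order.TTheory GRing.Theory Num.Theory.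
Import numFieldNormedType.Exports.

Local Open Scope classical_set_scope.
Local Open Scope ring_scope.

(* R^n carries the Borel sigma-algebra of its (product) topology. *)
HB.instance Definition _ (R : realType) (n : nat) :=
  @isMeasurable.Build (sigma_display (@open 'rV[R]_n)) 'rV[R]_n
    <<s @open 'rV[R]_n >> (@sigma_algebra0 _ setT _) (@sigma_algebraC _ _)
    (@sigma_algebra_bigcup _ setT _).

Lemma measurable_open (R : realType) n (U : set 'rV[R]_n) :
  open U -> measurable U.
Proof. by move=> oU; exact: sub_sigma_algebra. Qed.

Lemma measurable_closed (R : realType) n (F : set 'rV[R]_n) :
  closed F -> measurable F.
Proof.
by move=> cF; rewrite -[F]setCK; apply: measurableC; apply: measurable_open; rewrite openC.
Qed.

Definition qbox (R : realType) n (c : 'rV[rat]_n) (k : nat) : set 'rV[R]_n :=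
  [set x | forall i, `|x ord0 i - ratr (c ord0 i)| < k.+1%:R^-1].

Lemma open_bigcup_qbox (R : realType) n (U : set 'rV[R]_n) : open U ->
  U = \bigcup_(p in [set p : 'rV[rat]_n * nat | qbox p.1 p.2 `<=` U])
        qbox p.1 p.2.
Proof.
move=> oU; apply/seteqP; split => [x Ux|x [p /= pU xp]]; last exact: pU.
have /nbhs_ballP[e /= e0 eU] : nbhs x U by exact: open_nbhs_nbhs.
have e20 : 0 < e / 2 by rewrite divr_gt0.
have [k _ /(_ _ (leqnn _)) /= ke] := near_infty_natSinv_lt (PosNum e20).
have k0 : 0 < k.+1%:R^-1 :> R by rewrite invr_gt0.
have H i : {q : rat | `|x ord0 i - ratr q| < k.+1%:R^-1}.
  apply: cid.
  have [|q] := @rat_in_itvoo R (x ord0 i - k.+1%:R^-1) (x ord0 i + k.+1%:R^-1).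
    by rewrite ltrD2l gtrN.
  by rewrite in_itv/= => /andP[q1 q2]; exists q; rewrite distrC ltr_distl q1 q2.
pose c : 'rV[rat]_n := \row_i sval (H i).
exists (c, k) => /=; last by move=> i; rewrite mxE; case: (H i).
move=> y /= yc; apply: eU; split => // i j.
rewrite [i]ord1 /ball /=; have := yc j; rewrite mxE; case: (H j) => /= q xq yq.
rewrite -[_ - _](subrKA (ratr q)) (le_lt_trans (ler_normD _ _))//.
by rewrite [ltRHS](splitr e) ltrD ?(lt_trans xq)// distrC (lt_trans yq).
Qed.


Lemma qbox_bigcap (R : realType) n (c : 'rV[rat]_n) k :
  qbox c k = \bigcap_(i in [set: 'I_n])
    [set x : 'rV[R]_n | `|x ord0 i - ratr (c ord0 i)| < k.+1%:R^-1].
Proof. by apply/seteqP; split => x /= H i => [_|]; exact: H. Qed.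

Lemma open_sub_sigma_halfspaces (R : realType) n (M : set (set 'rV[R]_n)) :
  sigma_algebra setT M -> (forall (i : 'I_n) (a : R), M [set x : 'rV[R]_n | x ord0 i < a]) ->
  @open 'rV[R]_n `<=` M.
Proof.
move=> [M0 MD MU] Mlt U oU.
have MC A : M A -> M (~` A) by move=> /MD; rewrite setTD.
have MUc I (D : set I) (F : I -> set 'rV[R]_n) : countable D ->
    (forall i, D i -> M (F i)) -> M (\bigcup_(i in D) F i).
  move=> cD MF; have [->|/set0P[i0 Di0]] := eqVneq D set0.
    by rewrite bigcup_set0.
  have /countable_injP[f finj] := cD.
  pose G k := [set x | exists2 i, D i /\ f i = k & F i x].
  have -> : \bigcup_(i in D) F i = \bigcup_k G k.
    apply/seteqP; split => [x [i Di Fix]|x [k _ [i [Di _] Fix]]].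
      by exists (f i) => //; exists i.
    by exists i.
  apply: MU => k; have [[i [Di fik]]|H] := pselect (exists i, D i /\ f i = k).
    rewrite (_ : G k = F i); first exact: MF.
    apply/seteqP; split => x; last by exists i.
    move=> [j [Dj fjk] Fjx].
    by rewrite (finj i j) ?inE// fik.
  rewrite (_ : G k = set0)//; apply/seteqP; split => // x [i ? _].
  by apply: H; exists i.
have MIc I (D : set I) (F : I -> set 'rV[R]_n) : countable D ->
    (forall i, D i -> M (F i)) -> M (\bigcap_(i in D) F i).
  move=> cD MF; rewrite -[X in M X]setCK setC_bigcap; apply: (MC).
  by apply: MUc => // i Di; apply/MC/MF.
rewrite (open_bigcup_qbox oU); apply: MUc => [|[c k] _ /=]; first exact: countableP.
rewrite qbox_bigcap; apply: (MIc) => // i _.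
have -> : [set x : 'rV[R]_n | `|x ord0 i - ratr (c ord0 i)| < k.+1%:R^-1] =
  \bigcap_(b in [set: bool]) if b then
     [set x : 'rV[R]_n | x ord0 i < ratr (c ord0 i) + k.+1%:R^-1] else
     ~` (\bigcap_(m in [set: nat])
        [set x : 'rV[R]_n | x ord0 i < ratr (c ord0 i) - k.+1%:R^-1 + m.+1%:R^-1]).
  apply/seteqP; split => x /=.
    rewrite ltr_distl => /andP[x1 x2] [] _ //=.
    have x3 : 0 < x ord0 i - (ratr (c ord0 i) - k.+1%:R^-1) by rewrite subr_gt0.
    have [m _ /(_ _ (leqnn _)) /= mx] := near_infty_natSinv_lt (PosNum x3).
    move=> /(_ m Logic.I) /=; apply/negP; rewrite -leNgt -lerBrDl.
    exact: ltW.
  move=> H; have /= H1 := H true Logic.I; have /= H2 := H false Logic.I.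
  rewrite ltr_distl H1 andbT; move/contra_notP : H2 => H2.
  rewrite ltNge; apply/negP => H3; apply: (H false Logic.I) => /= m _ /=.
  by rewrite (le_lt_trans H3)// ltrDl invr_gt0.
apply: (MIc) => // -[] _ //.
by apply/MC/MIc => // m _; exact: Mlt.
Qed.

Lemma measurable_rV d (T : measurableType d) (R : realType) n
    (f : T -> 'rV[R]_n) :
  (forall i, measurable_fun setT (fun t => f t ord0 i)) ->
  measurable_fun setT f.
Proof.
move=> mf.
apply: (@measurability _ _ _ _ _ _ (@open 'rV[R]_n)) => // _ [U oU <-].
rewrite setTI; pose M := [set A : set 'rV[R]_n | measurable (f @^-1` A)].
suff : M U by [].
apply: (@open_sub_sigma_halfspaces R n M) => //.
  split; rewrite /M /=.
  - by rewrite preimage_set0.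
  - by move=> A mA; rewrite setTD preimage_setC; exact: measurableC.
  - by move=> F mF; rewrite preimage_bigcup; exact: bigcupT_measurable.
move=> i a; rewrite /M /=.
rewrite (_ : _ @^-1` _ = setT `&` (fun t => f t ord0 i) @^-1` `]-oo, a[%classic).
  by apply: mf => //; exact: measurable_itv.
by rewrite setTI; apply/seteqP; split => t /=; rewrite in_itv.
Qed.


Lemma measurable_continuous (R : realType) n (f : 'rV[R]_n -> R) :
  continuous f -> measurable_fun setT f.
Proof.
move=> /continuousP cf.
apply: (measurability _ (RGenOpens.measurableE R)) => // _ [_ [a [b ->] <-]].
by rewrite setTI; apply: measurable_open; apply: cf; exact: interval_open.
Qed.

Lemma measurable_coord (R : realType) n (i : 'I_n) :
  measurable_fun setT (fun x : 'rV[R]_n => x ord0 i).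
Proof. by apply: measurable_continuous => x; exact: coord_continuous. Qed.

Definition consV (R : realType) n (p : R * 'rV[R]_n) : 'rV[R]_n.+1 :=
  \row_i if unlift ord0 i is Some j then p.2 ord0 j else p.1.

Lemma consV0 (R : realType) n (p : R * 'rV[R]_n) : consV p ord0 ord0 = p.1.
Proof. by rewrite mxE unlift_none. Qed.

Lemma consVS (R : realType) n (p : R * 'rV[R]_n) (i : 'I_n) :
  consV p ord0 (lift ord0 i) = p.2 ord0 i.
Proof. by rewrite mxE liftK. Qed.

Lemma measurable_consV (R : realType) n :
  measurable_fun setT (@consV R n : measurableTypeR R * 'rV[R]_n -> 'rV[R]_n.+1).
Proof.
apply: measurable_rV => i; case: (unliftP ord0 i) => [j|] -> /=.
  under eq_fun do rewrite consVS.
  exact: measurableT_comp (@measurable_coord R n j) _.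
by under eq_fun do rewrite consV0; exact: measurable_fst.
Qed.

(* n-dimensional Lebesgue measure on the Borel sets of R^n, as the n-fold product
   of the one-dimensional one. *)
Fixpoint lebesgue_rV (R : realType) (n : nat) : set 'rV[R]_n -> \bar R :=
  match n with
  | 0 => \d_(0 : 'rV[R]_0)
  | m.+1 => pushforward (@lebesgue_measure R \x @lebesgue_rV R m)%E (@consV R m)
  end.

Section pushforward_consV.
Context (R : realType) (n : nat) (mu : set 'rV[R]_n -> \bar R).
Hypothesis mu0 : mu set0 = 0%E.
Hypothesis mu_ge0 : forall A, (0 <= mu A)%E.
Hypothesis mu_sigma_additive : semi_sigma_additive mu.
Hypothesis mu_sigma_finite : sigma_finite setT mu.

HB.instance Definition _ := isMeasure.Build _ _ _ mu
  mu0 mu_ge0 mu_sigma_additive.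
HB.instance Definition _ := Measure_isSigmaFinite.Build _ _ _ mu
  mu_sigma_finite.

Let nu := (@lebesgue_measure R \x mu)%E.

Let pushforward_consV0 : pushforward nu (@consV R n) set0 = 0%E.
Proof. by rewrite /pushforward preimage_set0 /nu measure0. Qed.

Let pushforward_consV_ge0 A : (0 <= pushforward nu (@consV R n) A)%E.
Proof. by rewrite /pushforward /nu; exact: measure_ge0. Qed.

Let pushforward_consV_sigma_additive :
  semi_sigma_additive (pushforward nu (@consV R n)).
Proof.
move=> F mF tF mUF; rewrite /pushforward /nu preimage_bigcup.
apply: measure_semi_sigma_additive.
- by move=> k; rewrite -[X in measurable X]setTI; exact: measurable_consV.
- apply/trivIsetP => /= i j _ _ ij; rewrite -preimage_setI.
  by move/trivIsetP : tF => /(_ _ _ _ _ ij) ->//; rewrite preimage_set0.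
- rewrite -preimage_bigcup -[X in measurable X]setTI.
  exact: measurable_consV.
Qed.

Let pushforward_consV_sigma_finite :
  sigma_finite setT (pushforward nu (@consV R n)).
Proof.
have [F FT mF] : sigma_finite setT nu.
  have /sigma_finiteP[F [TF ndF Foo]] := sigma_finiteT (@lebesgue_measure R).
  have /sigma_finiteP[G [TG ndG Goo]] := sigma_finiteT mu.
  exists (fun k => F k `*` G k).
    rewrite -setXTT TF TG predeqE => -[x y]; split.
      move=> [/= [i _ Fix] [j _ Gjy]]; exists (maxn i j) => //; split.
      - by move: x Fix; exact/subsetPset/ndF/leq_maxl.
      - by move: y Gjy; exact/subsetPset/ndG/leq_maxr.
    by move=> [i _ []/= ? ?]; split; exists i.
  move=> k; have [? ?] := Foo k; have [? ?] := Goo k.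
  split; first exact: measurableX.
  by rewrite /nu product_measure1E// lte_mul_pinfty// ge0_fin_numE.
pose h (y : 'rV[R]_n.+1) : measurableTypeR R * 'rV[R]_n :=
  (y ord0 ord0, \row_i y ord0 (lift ord0 i)).
have mh : measurable_fun setT h.
  apply/measurable_fun_pairP; split.
    exact: (@measurable_coord R n.+1 ord0).
  apply: measurable_rV => i; rewrite /comp /h /=.
  under eq_fun do rewrite mxE.
  exact: (@measurable_coord R n.+1 (lift ord0 i)).
exists (fun k => h @^-1` F k); first by rewrite -preimage_bigcup -FT preimage_setT.
move=> k; have [mFk Fk] := mF k; split.
  by rewrite -[X in measurable X]setTI; exact: mh.
rewrite /pushforward -comp_preimage (_ : h \o @consV R n = id) ?preimage_id//.
apply/funext => -[a x]; rewrite /h /= consV0; congr pair.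
by apply/rowP => i; rewrite mxE consVS.
Qed.

Lemma pushforward_consV_measure (nu' := pushforward nu (@consV R n)) :
  [/\ nu' set0 = 0%E, forall A, (0 <= nu' A)%E, semi_sigma_additive nu' &
      sigma_finite setT nu'].
Proof. by []. Qed.

End pushforward_consV.

Lemma lebesgue_rV_spec (R : realType) n (mu := @lebesgue_rV R n) :
  [/\ mu set0 = 0%E, forall A, (0 <= mu A)%E, semi_sigma_additive mu &
      sigma_finite setT mu].
Proof.
rewrite {}/mu; elim: n => [|n [h1 h2 h3 h4]]; last exact: pushforward_consV_measure.
pose m : {sigma_finite_measure set 'rV[R]_0 -> \bar R} := \d_(0 : 'rV[R]_0).
split; [exact: (measure0 m)|exact: (measure_ge0 m)| |exact: (sigma_finiteT m)].
exact: (@measure_semi_sigma_additive _ _ _ m).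
Qed.

Section lebesgue_rV_instances.
Context (R : realType) (n : nat).

Let lebesgue_rV0 : lebesgue_rV (set0 : set 'rV[R]_n) = 0%E.
Proof. by have [] := lebesgue_rV_spec R n. Qed.

Let lebesgue_rV_ge0 (A : set 'rV[R]_n) : (0 <= lebesgue_rV A)%E.
Proof. by have [] := lebesgue_rV_spec R n. Qed.

Let lebesgue_rV_sigma_additive : semi_sigma_additive (@lebesgue_rV R n).
Proof. by have [] := lebesgue_rV_spec R n. Qed.

Let lebesgue_rV_sigma_finite : sigma_finite setT (@lebesgue_rV R n).
Proof. by have [] := lebesgue_rV_spec R n. Qed.

HB.instance Definition _ := isMeasure.Build _ _ _ (@lebesgue_rV R n)
  lebesgue_rV0 lebesgue_rV_ge0 lebesgue_rV_sigma_additive.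
HB.instance Definition _ := Measure_isSigmaFinite.Build _ _ _ (@lebesgue_rV R n)
  lebesgue_rV_sigma_finite.

End lebesgue_rV_instances.

(* The library norm `|x| on row vectors is the sup norm; this is the Euclidean
   norm. *)
Definition enorm (R : realType) n (x : 'rV[R]_n) : R :=
  Num.sqrt (\sum_(i < n) x ord0 i ^+ 2).

(* Euclidean diameter; the diameter of the empty set is -oo. *)
Definition ediam (R : realType) n (A : set 'rV[R]_n) : \bar R :=
  ereal_sup [set (enorm (x - y))%:E | x in A & y in A].

(* The empty set is treated apart so that it costs 0 also when s = 0. The customary
   normalising constant, which makes the s-dimensional measure agree with Lebesgue
   measure on R^s, is omitted: below, Hausdorff measures only occur normalized to
   total mass 1. *)
Definition hausdorff_gauge (R : realType) n (s : nat) (A : set 'rV[R]_n) :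
    \bar R :=
  if A == set0 then 0%E else (ediam A ^+ s)%E.

Definition hausdorff_delta (R : realType) n (s : nat) (delta : R)
    (X : set 'rV[R]_n) : \bar R :=
  ereal_inf [set (\sum_(k <oo) hausdorff_gauge s (A k))%E |
    A in [set A : (set 'rV[R]_n)^nat |
           (forall k, (ediam (A k) <= delta%:E)%E) /\ X `<=` \bigcup_k A k]].

Definition hausdorff (R : realType) n (s : nat) (X : set 'rV[R]_n) : \bar R :=
  ereal_sup [set hausdorff_delta s delta X | delta in [set delta : R | 0 < delta]].

Section hausdorff_outer.
Context (R : realType) (n s : nat).
Implicit Types (A B X : set 'rV[R]_n) (delta : R).
Local Open Scope ereal_scope.

Lemma enorm0 : enorm (0 : 'rV[R]_n) = 0%R.
Proof. by rewrite /enorm big1 ?sqrtr0// => i _; rewrite mxE expr0n. Qed.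

Lemma ler_coord_enorm (x : 'rV[R]_n) i : (`|x ord0 i| <= enorm x)%R.
Proof.
rewrite -sqrtr_sqr ler_wsqrtr// (bigD1 i)//= lerDl.
by apply: sumr_ge0 => j _; exact: sqr_ge0.
Qed.

Lemma ediam_ge0 A : A != set0 -> 0 <= ediam A.
Proof.
move=> /set0P[x Ax]; apply: ereal_sup_ubound => /=.
by exists x => //; exists x => //; rewrite subrr enorm0.
Qed.

Lemma hausdorff_gauge0 : hausdorff_gauge s (set0 : set 'rV[R]_n) = 0.
Proof. by rewrite /hausdorff_gauge eqxx. Qed.

Lemma hausdorff_gauge_ge0 A : 0 <= hausdorff_gauge s A.
Proof.
rewrite /hausdorff_gauge; case: ifPn => // A0.
by rewrite expe_ge0// ediam_ge0.
Qed.

Let T' := g_sigma_algebraType [set: set 'rV[R]_n].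

Let gauge' delta (A : set T') : \bar R :=
  if ediam A <= delta%:E then hausdorff_gauge s A else +oo.

Let ediam0 : ediam (set0 : set 'rV[R]_n) = -oo.
Proof.
rewrite /ediam (_ : [set _ | _ in _ & _ in _] = set0) ?ereal_sup0//.
by apply/seteqP; split => // x [].
Qed.

Let gauge'0 delta : gauge' delta set0 = 0.
Proof. by rewrite /gauge' ediam0 leNye hausdorff_gauge0. Qed.

Let gauge'_ge0 delta A : 0 <= gauge' delta A.
Proof. by rewrite /gauge'; case: ifP => // _; exact: hausdorff_gauge_ge0. Qed.

Let hausdorff_deltaE delta X : hausdorff_delta s delta X = mu_ext (gauge' delta) X.
Proof.
apply/eqP; rewrite eq_le; apply/andP; split.
  apply: le_ereal_inf_tmp => _ [A [mA XA] <-].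
  have [Ad|] := pselect (forall k, ediam (A k) <= delta%:E).
    apply: ereal_inf_lbound; exists A => //.
    by apply: eq_eseriesr => k _; rewrite /gauge' Ad.
  move=> /existsNP[k /negP Ak].
  rewrite (@eseries_pinfty _ _ _ k) ?leey//.
    by move=> j _; rewrite -ltNye (lt_le_trans _ (gauge'_ge0 _ _)).
  by rewrite /gauge' (negbTE Ak).
apply: le_ereal_inf_tmp => _ [A [Ad XA] <-].
apply: ereal_inf_lbound; exists A.
  by split => // k; exact: sub_sigma_algebra.
by apply: eq_eseriesr => k _; rewrite /gauge' Ad.
Qed.

Lemma hausdorff_delta0 delta : hausdorff_delta s delta (set0 : set 'rV[R]_n) = 0.
Proof. by rewrite hausdorff_deltaE mu_ext0. Qed.

Lemma hausdorff_delta_ge0 delta A : 0 <= hausdorff_delta s delta A.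
Proof. by rewrite hausdorff_deltaE mu_ext_ge0. Qed.

Lemma le_hausdorff_delta delta :
  {homo @hausdorff_delta R n s delta : A B / A `<=` B >-> A <= B}.
Proof. by move=> A B AB; rewrite !hausdorff_deltaE; exact: le_mu_ext. Qed.

Lemma hausdorff_delta_sigma_subadditive delta :
  sigma_subadditive (@hausdorff_delta R n s delta).
Proof.
move=> F; rewrite hausdorff_deltaE.
under eq_eseriesr do rewrite hausdorff_deltaE.
exact: mu_ext_sigma_subadditive.
Qed.

Lemma le_hausdorff_delta_hausdorff delta A :
  (0 < delta)%R -> hausdorff_delta s delta A <= hausdorff s A.
Proof. by move=> d0; apply: ereal_sup_ubound; exists delta. Qed.

Let hausdorff0 : hausdorff s (set0 : set 'rV[R]_n) = 0.
Proof.
apply/eqP; rewrite eq_le; apply/andP; split.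
  by apply: ge_ereal_sup => _ [d _ <-]; rewrite hausdorff_delta0.
by rewrite -(hausdorff_delta0 1); exact: le_hausdorff_delta_hausdorff.
Qed.

Let hausdorff_ge0 A : 0 <= hausdorff s A.
Proof.
by rewrite (le_trans (hausdorff_delta_ge0 1 A))// le_hausdorff_delta_hausdorff.
Qed.

Let le_hausdorff : {homo @hausdorff R n s : A B / A `<=` B >-> A <= B}.
Proof.
move=> A B AB; apply: ge_ereal_sup => _ [d /= d0 <-].
by rewrite (le_trans (le_hausdorff_delta d AB))// le_hausdorff_delta_hausdorff.
Qed.

Let hausdorff_sigma_subadditive : sigma_subadditive (@hausdorff R n s).
Proof.
move=> F; apply: ge_ereal_sup => _ [d /= d0 <-].
rewrite (le_trans (hausdorff_delta_sigma_subadditive d F))//.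
apply: lee_nneseries => [k _ _|k _]; first exact: hausdorff_delta_ge0.
exact: (le_hausdorff_delta_hausdorff _ d0).
Qed.

HB.instance Definition _ := isOuterMeasure.Build _ _ (@hausdorff R n s)
  hausdorff0 hausdorff_ge0 le_hausdorff hausdorff_sigma_subadditive.

Lemma le_hausdorff_delta_mesh (d1 d2 : R) A : (d1 <= d2)%R ->
  hausdorff_delta s d2 A <= hausdorff_delta s d1 A.
Proof.
move=> d12; apply: le_ereal_inf_tmp => _ [C [Cd AC] <-].
apply: ereal_inf_lbound; exists C => //; split => // k.
by rewrite (le_trans (Cd k))// lee_fin.
Qed.

Lemma hausdorff_delta_metric delta (c : R) A B : (delta < c)%R ->
  (forall x y, A x -> B y -> c <= enorm (x - y))%R ->
  hausdorff_delta s delta A + hausdorff_delta s delta B <=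
  hausdorff_delta s delta (A `|` B).
Proof.
move=> dc cAB; apply: le_ereal_inf_tmp => _ [C [Cd ABC] <-].
pose P (D : set 'rV[R]_n) k := if C k `&` D == set0 then set0 else C k.
have Pd D k : ediam (P D k) <= delta%:E.
  by rewrite /P; case: ifP => // _; rewrite ediam0 leNye.
have Pc D : D `<=` A `|` B -> D `<=` \bigcup_k P D k.
  move=> DAB x Dx; have [k _ Ckx] := ABC _ (DAB _ Dx); exists k => //.
  by rewrite /P; case: ifPn => // /eqP CD0; rewrite -CD0.
apply: (@le_trans _ _ (\sum_(k <oo) hausdorff_gauge s (P A k) +
                       \sum_(k <oo) hausdorff_gauge s (P B k))).
  apply: leeD; apply: ereal_inf_lbound.
    by exists (P A) => //; split => //; apply: Pc => x; left.
  by exists (P B) => //; split => //; apply: Pc => x; right.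
rewrite -nneseriesD; [|by move=> *; exact: hausdorff_gauge_ge0..].
apply: lee_nneseries => [k _ _|k _].
  by rewrite adde_ge0// hausdorff_gauge_ge0.
rewrite /P; case: ifPn => [_|/set0P[x [Cx Ax]]].
  rewrite hausdorff_gauge0 add0e; case: ifP => // _.
  by rewrite hausdorff_gauge0 hausdorff_gauge_ge0.
case: ifPn => [_|/set0P[y [Cy By]]]; first by rewrite hausdorff_gauge0 adde0.
have : (enorm (x - y))%:E <= delta%:E.
  apply: le_trans (Cd k); apply: ereal_sup_ubound => /=.
  by exists x => //; exists y.
rewrite lee_fin => /(le_trans (cAB _ _ Ax By)).
by rewrite leNgt dc.
Qed.

Lemma hausdorff_metric (c : R) A B : (0 < c)%R ->
  (forall x y, A x -> B y -> c <= enorm (x - y))%R ->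
  hausdorff s A + hausdorff s B <= hausdorff s (A `|` B).
Proof.
move=> c0 cAB; have [->|ABoo] := eqVneq (hausdorff s (A `|` B)) +oo.
  by rewrite leey.
have Hfin D : D `<=` A `|` B -> hausdorff s D \is a fin_num.
  move=> DAB; rewrite ge0_fin_numE ?outer_measure_ge0//.
  by rewrite (le_lt_trans (le_outer_measure _ _ _ DAB))// ltey.
have HA : hausdorff s A \is a fin_num by apply: Hfin => x; left.
have HB : hausdorff s B \is a fin_num by apply: Hfin => x; right.
rewrite -leeBrDr//; apply: ge_ereal_sup => _ [d1 /= d10 <-].
have hdfin (d : R) (D : set 'rV[R]_n) : hausdorff s D \is a fin_num -> (0 < d)%R ->
    hausdorff_delta s d D \is a fin_num.
  move=> Dfin d0; rewrite ge0_fin_numE ?hausdorff_delta_ge0//.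
  by rewrite (le_lt_trans (le_hausdorff_delta_hausdorff _ d0))// ltey_eq Dfin.
rewrite leeBrDr// addeC -leeBrDr ?hdfin//.
apply: ge_ereal_sup => _ [d2 /= d20 <-].
rewrite leeBrDr ?hdfin// addeC.
pose d : R := (Num.min (c / 2) (Num.min d1 d2))%R.
have d0 : (0 < d)%R by rewrite !lt_min divr_gt0//= d10.
apply: (@le_trans _ _ (hausdorff_delta s d A + hausdorff_delta s d B)).
  by rewrite leeD// le_hausdorff_delta_mesh// /d !ge_min lexx !orbT.
rewrite (le_trans _ (le_hausdorff_delta_hausdorff _ d0))//.
apply: hausdorff_delta_metric cAB.
by rewrite /d !gt_min ltr_pdivrMr// ltr_pMr// ltr1n.
Qed.

End hausdorff_outer.

Section hausdorff_borel.
Context (R : realType) (n s : nat).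
Local Open Scope ereal_scope.
Let H : {outer_measure set 'rV[R]_n -> \bar R} := @hausdorff R n s.

Let Hmetric (c : R) A B : (0 < c)%R ->
  (forall x y, A x -> B y -> c <= enorm (x - y))%R -> H A + H B <= H (A `|` B).
Proof. exact: hausdorff_metric. Qed.

Lemma hausdorff_caratheodory_sublevel (g : 'rV[R]_n -> R) :
  (forall x y, g x - g y <= enorm (x - y))%R ->
  H.-caratheodory [set x | (g x <= 0)%R].
Proof.
move=> gL; apply: le_caratheodory_measurable => X.
have [->|HXoo] := eqVneq (H X) +oo; first by rewrite leey.
have HX : H X \is a fin_num by rewrite ge0_fin_numE ?outer_measure_ge0// ltey.
pose q (k : nat) : R := (k.+1%:R^-1)%R.
have q0 k : (0 < q k)%R by rewrite invr_gt0.
have qS k : (q k.+1 < q k)%R by rewrite ltf_pV2 ?posrE ?ltr_nat.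
have qle i j : (i <= j)%N -> (q j <= q i)%R.
  by move=> ij; rewrite lef_pV2 ?posrE ?ler_nat.
pose Y k := X `&` [set x | q k <= g x]%R.
pose D k := X `&` [set x | q k.+1 <= g x < q k]%R.
have sumD e N : \sum_(k < N) H (D (k.*2 + e)%N) <= H (\big[setU/set0]_(k < N) D (k.*2 + e)%N).
  elim: N => [|N IH]; first by rewrite !big_ord0 outer_measure0.
  rewrite !big_ord_recr /= (le_trans (leeD IH (lexx _)))//.
  pose m := (N.*2 + e)%N; case E : m => [|m'].
    have N0 : N = 0%N by move: E; rewrite /m; case: (N).
    by rewrite -/m E N0 !big_ord0 outer_measure0 add0e set0U.
  apply: (@Hmetric (q m' - q m'.+1)%R); first by rewrite subr_gt0.
  move=> x y; rewrite -(bigcup_mkord _ (fun k => D (k.*2 + e)%N)) => -[j /= jN [_ /= /andP[gx _]]].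
  rewrite -/m E => -[_ /= /andP[_ gy]].
  apply: le_trans (gL x y); rewrite lerB ?(ltW gy)//.
  apply: le_trans gx; apply: qle.
  by rewrite -ltnS -E /m -!addSn -doubleS leq_add2r leq_double.
have sumDX e N : \sum_(k < N) H (D (k.*2 + e)%N) <= H X.
  rewrite (le_trans (sumD e N))//; apply: le_outer_measure => x.
  by rewrite -(bigcup_mkord _ (fun k => D (k.*2 + e)%N)) => -[k _ []].
have sum2 N : \sum_(k < N.*2) H (D k) <= H X + H X.
  rewrite (_ : \sum_(k < N.*2) _ = \sum_(k < N) H (D (k.*2 + 0)%N) +
                                   \sum_(k < N) H (D (k.*2 + 1)%N)).
    exact: leeD.
  elim: N => [|N IH]; first by rewrite !big_ord0 adde0.
  by rewrite doubleS !big_ord_recr /= IH addn0 addn1 -!addeA; congr (_ + _);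
    rewrite addeCA.
have sumfin : \sum_(0 <= k <oo) H (D k) < +oo.
  apply: (@le_lt_trans _ _ (H X + H X)); last by rewrite ltey_eq fin_numD HX.
  apply: lime_le; first by apply: is_cvg_nneseries => *; exact: outer_measure_ge0.
  apply: nearW => N; rewrite (le_trans _ (sum2 N))// big_mkord.
  rewrite -!(big_mkord xpredT (fun k => H (D k))).
  by apply: lee_sum_nneg_natr => [k _ _|]; rewrite ?outer_measure_ge0// -addnn leq_addr.
have tail0 := nneseries_tail_cvg sumfin (fun k _ => outer_measure_ge0 H (D k)).
have bound k : H (X `&` [set x | g x <= 0]%R) + H (X `&` ~` [set x | g x <= 0]%R) <=
    H X + \sum_(k <= i <oo) H (D i).
  have HY : H (X `&` [set x | g x <= 0]%R) + H (Y k) <= H X.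
    rewrite addeC; apply: (@le_trans _ _ (H (Y k `|` (X `&` [set x | g x <= 0]%R)))).
      apply: (@Hmetric (q k)) => // x y [_ /= gx] [_ /= gy].
      apply: le_trans (gL x y); rewrite (le_trans gx)// lerBrDr.
      by rewrite gerDl.
    by apply: le_outer_measure => x [] [].
  apply: le_trans (leeD HY (lexx _)); rewrite -addeA leeD//.
  apply: le_trans (leeD (lexx _) (outer_measure_sigma_subadditive_tail H k D)).
  apply: le_trans (outer_measureU2 _ _ _); apply: le_outer_measure => x [Xx].
  move=> /= /negP; rewrite -ltNge => gx.
  have [kx|kx] := leP (q k) (g x); [by left|right].
  have ex : exists m, (q m <= g x)%R.
    have [m _ /(_ _ (leqnn _)) /= mx] := near_infty_natSinv_lt (PosNum gx).
    by exists m; exact: ltW.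
  case: (ex_minnP ex) => -[|m] qm mmin.
    by move: kx; rewrite ltNge (le_trans _ qm)// qle.
  exists m; last by split => //=; rewrite qm/= ltNge; apply/negP => /mmin; rewrite ltnn.
  by move=> /= mk; move: kx; rewrite ltNge (le_trans (qle _ _ mk) qm).
have cv : H X + \sum_(k <= i <oo) H (D i) @[k --> \oo] --> H X + 0.
  by apply: cvgeD => //; [exact: fin_num_adde_defr|exact: cvg_cst].
rewrite -[leRHS]adde0 -(cvg_lim _ cv)//; apply: lime_ge.
  by apply/cvg_ex; exists (H X + 0).
by apply: nearW => k; exact: bound.
Qed.

Lemma hausdorff_caratheodory_borel : measurable `<=` H.-caratheodory.
Proof.
have sH : sigma_algebra setT H.-caratheodory.
  split.
  - exact: caratheodory_measurable_set0.
  - by move=> A mA; rewrite setTD; exact: caratheodory_measurable_setC.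
  - by move=> F mF; exact: caratheodory_measurable_bigcup.
apply: smallest_sub => //; apply: open_sub_sigma_halfspaces => // i a.
rewrite (_ : [set x : 'rV[R]_n | x ord0 i < a]%R = ~` [set x : 'rV[R]_n | a - x ord0 i <= 0]%R).
  apply/caratheodory_measurable_setC/hausdorff_caratheodory_sublevel => x y.
  rewrite (_ : _ - _ = - (x - y) ord0 i)%R; last by rewrite !mxE; lra.
  by rewrite (le_trans (ler_norm _))// normrN ler_coord_enorm.
by apply/seteqP; split => x /=; rewrite subr_le0 ltNge => /negP.
Qed.

End hausdorff_borel.

Section hausdorff_measure.
Context (R : realType) (n s : nat).
Local Open Scope ereal_scope.
Let H : {outer_measure set 'rV[R]_n -> \bar R} := @hausdorff R n s.

Let hausdorff0 : hausdorff s (set0 : set 'rV[R]_n) = 0.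
Proof. exact: (outer_measure0 H). Qed.

Let hausdorff_ge0 (A : set 'rV[R]_n) : 0 <= hausdorff s A.
Proof. exact: (outer_measure_ge0 H). Qed.

Let hausdorff_sigma_additive : semi_sigma_additive (@hausdorff R n s).
Proof.
move=> F mF tF mUF.
apply: (@caratheodory_measure_sigma_additive _ _ H) => //.
  by move=> k; exact: hausdorff_caratheodory_borel.
exact: hausdorff_caratheodory_borel.
Qed.

HB.instance Definition _ := isMeasure.Build _ _ _ (@hausdorff R n s)
  hausdorff0 hausdorff_ge0 hausdorff_sigma_additive.

End hausdorff_measure.

Record convexBody (R : realType) (n : nat) := ConvexBody {
  body :> set 'rV[R]_n ;
  body_convex : convex_set body ;
  body_compact : compact body ;
  body_interior : body° !=set0 }.

Definition boundary (T : topologicalType) (A : set T) : set T :=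
  closure A `\` A°.

Lemma measurable_body (R : realType) n (K : convexBody R n) :
  measurable (K : set 'rV[R]_n).
Proof.
apply: measurable_closed; apply: compact_closed; first exact: norm_hausdorff.
exact: (@body_compact R n K).
Qed.

Lemma measurable_boundary (R : realType) n (A : set 'rV[R]_n) :
  measurable (boundary A).
Proof.
apply: measurableD; first by apply: measurable_closed; exact: closed_closure.
by apply: measurable_open; exact: open_interior.
Qed.

(* mu restricted to D and divided by mu D. The last argument of mnormalize is a
   default value, used only when mu D is 0 or +oo; this does not happen for Lebesgue
   measure on a convex body nor for (d-1)-dimensional Hausdorff measure on its
   boundary. *)
Definition uniform_on (R : realType) n (mu : {measure set 'rV[R]_n -> \bar R})
    (D : set 'rV[R]_n) (mD : measurable D) : probability 'rV[R]_n R :=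
  mnormalize (mrestr mu mD) (\d_(0 : 'rV[R]_n)).

(* E|X - Y| for independent X and Y of law P: they are realised as the two
   projections from the product probability space. *)
Definition mean_distance (R : realType) n (P : probability 'rV[R]_n R) :
    \bar R :=
  ('E_(P \x P)[fun z => enorm (z.1 - z.2)])%E.

Definition Delta (R : realType) d (K : convexBody R d) : \bar R :=
  mean_distance (uniform_on (@lebesgue_rV R d) (measurable_body K)).

Definition theta (R : realType) d (K : convexBody R d) : \bar R :=
  mean_distance (uniform_on (@hausdorff R d d.-1) (measurable_boundary K)).

(* Main.v *)
(* Coordinates x_0 = u, x_1, ..., x_m, x_{m+1} on R^(m+2), n = m+1 >= 2. The
   wedge 0 <= u <= 1, 0 <= x_i <= delta u, 0 <= x_{m+1} <= eta (2 - u), with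
   eta << delta << 1, is so thin that only the coordinate u matters. Its surface
   is nearly exhausted by the two sheets x_{m+1} = 0 and x_{m+1} = eta (2 - u).
   Each of them is a cone over its apex, so that u has distribution function
   exactly t^n on both, merely because Hausdorff measure scales like t^n. For the
   volume the density of u is proportional to u^(n-1) (2 - u). The mean
   difference of a variable on [0, 1] with distribution function F is the
   integral of 2 F (1 - F); the values for volume and surface differ by
   2 n (2 n^2 - 3) / ((n+1) (2n+1) (n+2)^2 (2n+3)) > 0.
   Were the Hausdorff measure of the boundary 0 or infinite, the default law in
   [uniform_on] would make theta vanish; so neither case has to be excluded. *)
Require Import Defs.
From mathcomp Require Import all_boot all_order all_algebra.
From mathcomp Require Import all_classical all_reals all_analysis.
From mathcomp Require Import perm measurable_realfun ring lra.

Set Implicit Arguments.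
Unset Strict Implicit.
Unset Printing Implicit Defensive.

Import Order.TTheory GRing.Theory Num.Theory.
Import numFieldNormedType.Exports.

Local Open Scope classical_set_scope.
Local Open Scope ring_scope.

(** * Hausdorff measure and Lipschitz maps *)

Section enorm.
Context {R : realType}.

Lemma enormZ n (a : R) (x : 'rV[R]_n) : enorm (a *: x) = `|a| * enorm x.
Proof.
rewrite /enorm -sqrtr_sqr -sqrtrM ?sqr_ge0// mulr_sumr.
by under eq_bigr do rewrite mxE exprMn.
Qed.

Lemma enorm_le_sum n (x : 'rV[R]_n) : enorm x <= \sum_(i < n) `|x ord0 i|.
Proof.
have S0 : 0 <= \sum_(i < n) `|x ord0 i| by exact: sumr_ge0.
rewrite -(ler_sqr (sqrtr_ge0 _) S0) sqr_sqrtr ?sumr_ge0// => [|i _]; last exact: sqr_ge0.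
rewrite expr2 mulr_suml; apply: ler_sum => i _.
rewrite -real_normK ?num_real// expr2 ler_wpM2l//.
by rewrite (bigD1 i)//= lerDl sumr_ge0.
Qed.

(** Passing through the sum norm costs a factor [p] where the square root of [p] would be optimal.
    Any constant independent of [eta] is good enough for the estimates of the sides. *)
Lemma enorm_le_coord n p (L : R) (x : 'rV[R]_n) (y : 'rV[R]_p) :
  (forall i, `|y ord0 i| <= L * enorm x) -> enorm y <= (p%:R * L) * enorm x.
Proof.
move=> yx; rewrite (le_trans (enorm_le_sum y))// -mulrA mulr_natl.
rewrite (le_trans (ler_sum _ (fun i _ => yx i)))//.
by rewrite sumr_const card_ord.
Qed.

End enorm.

Section hausdorff_image.
Context {R : realType}.
Local Open Scope ereal_scope.

Lemma ediam_image n p (L : R) (f : 'rV[R]_n -> 'rV[R]_p) (C : set 'rV[R]_n) :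
  (0 < L)%R -> (forall x y, enorm (f x - f y) <= L * enorm (x - y))%R ->
  ediam (f @` C) <= L%:E * ediam C.
Proof.
move=> L0 fL; apply: ge_ereal_sup => _ [_ [x Cx <-]] [_ [y Cy <-]] <-.
apply: (@le_trans _ _ (L%:E * (enorm (x - y))%:E)); first by rewrite lee_fin.
rewrite lee_pmul2l//; apply: ereal_sup_ubound.
by exists x => //; exists y.
Qed.

(** A cover of [B] of mesh [e / L] is mapped to a cover of [A] of mesh [e], and each gauge grows at
    most by the factor L^s. Asking for an inclusion only lets the lemma absorb monotonicity. *)
Lemma hausdorff_lipschitz n p s (L : R) (f : 'rV[R]_n -> 'rV[R]_p)
    (A : set 'rV[R]_p) (B : set 'rV[R]_n) :
  (0 < L)%R -> (forall x y, enorm (f x - f y) <= L * enorm (x - y))%R ->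
  A `<=` f @` B -> hausdorff s A <= (L ^+ s)%:E * hausdorff s B.
Proof.
move=> L0 fL AB; apply: ge_ereal_sup => _ [e /= e0 <-].
have Ls0 : (0 < L ^+ s)%R by rewrite exprn_gt0.
have eL0 : (0 < e / L)%R by rewrite divr_gt0.
apply: (@le_trans _ _ ((L ^+ s)%:E * hausdorff_delta s (e / L) B)); last first.
  by rewrite lee_pmul2l// le_hausdorff_delta_hausdorff.
rewrite -lee_pdivrMl//; apply: le_ereal_inf_tmp => _ [C [Cd BC] <-].
rewrite lee_pdivrMl//.
apply: (@le_trans _ _ (\sum_(k <oo) hausdorff_gauge s (f @` C k))).
  apply: ereal_inf_lbound; exists (fun k => f @` C k) => //; split.
    move=> k; rewrite (le_trans (ediam_image _ L0 fL))//.
    by rewrite muleC -lee_pdivlMr// (le_trans (Cd k)).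
  move=> x /AB[y /BC[k _ Cky] <-]; exists k => //; by exists y.
rewrite -nneseriesZl => [|k _]; last exact: hausdorff_gauge_ge0.
apply: lee_nneseries => [k _ _|k _]; first exact: hausdorff_gauge_ge0.
(* The gauge of the empty set is 0 by convention, so empty pieces are treated apart. For the others
   the image is nonempty too and both gauges are powers of diameters. *)
rewrite /hausdorff_gauge; have [->|Ck0] := eqVneq (C k) set0.
  by rewrite image_set0 eqxx mule0.
have fC0 : f @` C k != set0.
  by case/set0P: Ck0 => y Cy; apply/set0P; exists (f y), y.
rewrite (negbTE fC0).
elim: s {Ls0} => [|s IH]; first by rewrite expr0 !expe0 mule1.
rewrite exprS !expeS EFinM muleACA lee_pmul ?expe_ge0 ?ediam_ge0//.
exact: ediam_image.
Qed.

End hausdorff_image.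

Lemma measurable_coord_itv {R : realType} n (i : 'I_n) (I : interval R) :
  measurable [set x : 'rV[R]_n | x ord0 i \in I].
Proof.
by have /(_ measurableT [set` I] (measurable_itv _)) := @measurable_coord R n i; rewrite setTI.
Qed.

Lemma measurable_coord_le {R : realType} n (i : 'I_n) (t : R) :
  measurable [set x : 'rV[R]_n | x ord0 i <= t].
Proof.
rewrite (_ : [set x | _] = [set x : 'rV[R]_n | x ord0 i \in `]-oo, t]]).
  exact: measurable_coord_itv.
by apply/seteqP; split => x /=; rewrite in_itv.
Qed.

(** * Homotheties, translations and thin slabs of a flat cube *)

Section flat_cube.
Context {R : realType} (n : nat).
Implicit Types (i : 'I_n.+1) (N : nat).
Local Notation V := 'rV[R]_n.+1.

Definition homothety (p : V) (t : R) (x : V) : V := p + t *: (x - p).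

Lemma homothetyE p t x i :
  homothety p t x ord0 i = p ord0 i + t * (x ord0 i - p ord0 i).
Proof. by rewrite !mxE. Qed.

Lemma homothetyK p t : t != 0 -> cancel (homothety p t^-1) (homothety p t).
Proof.
move=> t0 x; rewrite /homothety addrAC subrr add0r scalerA divff// scale1r.
by rewrite addrC subrK.
Qed.

Lemma hausdorff_homothety s (p : V) (t : R) (A B : set V) : 0 < t ->
  A `<=` homothety p t @` B -> (hausdorff s A <= (t ^+ s)%:E * hausdorff s B)%E.
Proof.
move=> t0; apply: hausdorff_lipschitz => // x y.
rewrite (_ : _ - _ = t *: (x - y)) ?enormZ ?gtr0_norm//.
by apply/rowP => i; rewrite !mxE; ring.
Qed.

Lemma hausdorff_translation s (v : V) (A B : set V) :
  A `<=` (fun x => x + v) @` B -> (hausdorff s A <= hausdorff s B)%E.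
Proof.
move=> /(@hausdorff_lipschitz _ _ _ s 1); rewrite expr1n mul1e; apply => // x y.
by rewrite mul1r opprD addrACA subrr addr0.
Qed.

(** A yardstick of dimension [n] in R^(n+1): sheets and sides of the wedge are both compared with
    it, so that the value of its Hausdorff measure never enters. *)
Definition flat_cube : set V :=
  [set x | x ord0 ord_max = 0 /\ forall i, 0 <= x ord0 i <= 1].

Definition slab i N : set V := flat_cube `&` [set x | x ord0 i < N%:R^-1].

Lemma measurable_flat_cube : measurable flat_cube.
Proof.
rewrite (_ : flat_cube = [set x : V | x ord0 ord_max \in `[0, 0]] `&`
    \bigcap_(i in [set: 'I_n.+1]) [set x : V | x ord0 i \in `[0, 1]]); last first.
  apply/seteqP; split => x /=; rewrite in_itv/=.
    by move=> [xm x01]; split => [|i _]; rewrite /= ?in_itv/= ?xm ?lexx.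
  rewrite -eq_le => -[/eqP xm x01]; split => // i.
  by have := x01 i Logic.I; rewrite /= in_itv.
apply: measurableI; first exact: measurable_coord_itv.
by apply: fin_bigcap_measurable => // i _; exact: measurable_coord_itv.
Qed.

(* The cube contains [N] disjoint translates of the slab. *)
Lemma hausdorff_slab s i N : i != ord_max -> (0 < N)%N ->
  (N%:R%:E * hausdorff s (slab i N) <= hausdorff s flat_cube)%E.
Proof.
move=> im N0; have NR0 : 0 < N%:R :> R by rewrite ltr0n.
(* Half-open slices are disjoint, so their measures add up. The slice [S k] contains the translate
   of the slab by k/N along the coordinate [i]. *)
pose S (k : 'I_N) := flat_cube `&`
  [set x : V | x ord0 i \in `[k%:R / N%:R, k.+1%:R / N%:R[].
have mS k : measurable (S k).
  by apply: measurableI; [exact: measurable_flat_cube|exact: measurable_coord_itv].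
have tS : trivIset setT S.
  apply/trivIsetP => j k _ _ jk; rewrite -subset0 => x [[_ +] [_ +]] /=.
  rewrite /= !in_itv/= !ler_pdivrMr// !ltr_pdivlMr// => /andP[jx xj] /andP[kx xk].
  have := le_lt_trans jx xk; have := le_lt_trans kx xj.
  rewrite !ltr_nat !ltnS => kj jk'.
  by case/eqP: jk; apply/val_inj/eqP; rewrite eqn_leq /= jk' kj.
have -> : (N%:R%:E * hausdorff s (slab i N) =
           \sum_(k < N) hausdorff s (slab i N))%E.
  by rewrite sumr_const card_ord mule_natl.
apply: (@le_trans _ _ (\sum_(k < N) hausdorff s (S k))%E); last first.
  rewrite -(measure_bigsetU_ord (@hausdorff R n.+1 s) xpredT)//.
  apply: le_measure; rewrite ?inE; [by apply: bigsetU_measurable|exact: measurable_flat_cube|].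
  by elim/big_ind : _ => // [|k _ x []//]; first by move=> A B AQ BQ x [/AQ|/BQ].
apply: lee_sum => k _.
pose v : V := (k%:R / N%:R) *: delta_mx ord0 i.
apply: (@hausdorff_translation _ (- v)) => x [[xm x01] /= xi].
exists (x + v); last by rewrite addrK.
have vE j : v ord0 j = if j == i then k%:R / N%:R else 0.
  by rewrite !mxE eqxx/=; case: eqP; rewrite (mulr1, mulr0).
have kN0 : 0 <= k%:R / N%:R :> R by rewrite divr_ge0.
have xi2 : x ord0 i + k%:R / N%:R < k.+1%:R / N%:R.
  by rewrite -natr1 mulrDl mul1r addrC ltrD2l.
split; last first.
  rewrite /= in_itv/= !mxE !eqxx mulr1 xi2 andbT lerDr.
  by have /andP[] := x01 i.
split; first by rewrite mxE vE eq_sym (negbTE im) addr0.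
move=> j; rewrite mxE vE; case: eqP => [->|_]; last by rewrite addr0.
have /andP[xi0 _] := x01 i; rewrite addr_ge0//=.
by rewrite (le_trans (ltW xi2))// ler_pdivrMr// mul1r ler_nat.
Qed.

End flat_cube.

(** * Mean difference of a random variable *)

Section integral_horner.
Context {R : realType}.
Local Notation mu := (@lebesgue_measure R).

Lemma integral_deriv_horner (q : {poly R}) (a b : R) : a <= b ->
  (\int[mu]_(t in `[a, b]) (q^`().[t])%:E = (q.[b] - q.[a])%:E)%E.
Proof.
rewrite le_eqVlt => /predU1P[<-|ab].
  by rewrite set_itv1 integral_set1 subrr.
rewrite EFinB; apply: continuous_FTC2 => //.
- by apply: continuous_subspaceT; exact: continuous_horner.
- split.
  + by move=> x _; exact: derivable_horner.
  + by apply: cvg_at_right_filter; exact: continuous_horner.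
  + by apply: cvg_at_left_filter; exact: continuous_horner.
- by move=> x _; rewrite derivE.
Qed.

End integral_horner.

Section mean_difference.
Context d (T : measurableType d) (R : realType) (P : probability T R).
Variables (u : T -> R).
Hypothesis measurable_u : measurable_fun setT u.
Local Notation lambda := (@lebesgue_measure R).
Local Open Scope ereal_scope.

Let F (t : R) : R := fine (P [set x | u x <= t]%R).

Let m_le (t : R) : measurable [set x | u x <= t]%R.
Proof.
have /(_ measurableT _ (measurable_itv `]-oo, t])) := measurable_u;
  rewrite setTI.
by congr measurable; apply/seteqP; split => x /=; rewrite in_itv.
Qed.

Let PF t : P [set x | u x <= t]%R = (F t)%:E.
Proof. by rewrite fineK// fin_num_measure. Qed.

Lemma measurable_cdf_fine : measurable_fun setT F.
Proof.
apply: nondecreasing_measurable => // s t st.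
rewrite fine_le ?fin_num_measure// le_measure ?inE// => x /= /le_trans; exact.
Qed.

Lemma cdf_fine_itv t : (0 <= F t <= 1)%R.
Proof. by rewrite -2!lee_fin -PF measure_ge0 probability_le1. Qed.

(** Triples (x, y, t) whose level t separates [u x] from [u y]. The half-open convention matches
    that of [F], so that the sections at fixed t are exactly unions of rectangles. *)
Let E : set ((T * T) * measurableTypeR R) :=
  [set w | u w.1.1 <= w.2 < u w.1.2 \/ u w.1.2 <= w.2 < u w.1.1]%R.

Let mE : measurable E.
Proof.
have m1 : measurable_fun setT (fun w : (T * T) * measurableTypeR R => u w.1.1).
  by apply: measurableT_comp => //; exact: measurableT_comp.
have m2 : measurable_fun setT (fun w : (T * T) * measurableTypeR R => u w.1.2).
  by apply: measurableT_comp => //; exact: measurableT_comp.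
have m3 : measurable_fun setT (fun w : (T * T) * measurableTypeR R => w.2 : R).
  exact: measurable_snd.
have mb (f : (T * T) * measurableTypeR R -> bool) :
    measurable_fun setT f -> measurable [set w | f w].
  by move=> /(_ measurableT [set true] I); rewrite setTI.
rewrite (_ : E = [set w | u w.1.1 <= w.2]%R `&` [set w | w.2 < u w.1.2]%R `|`
  [set w | u w.1.2 <= w.2]%R `&` [set w | w.2 < u w.1.1]%R).
  by apply: measurableU; apply: measurableI; apply: mb;
    (exact: measurable_fun_ler || exact: measurable_fun_ltr).
apply/seteqP; split => w /=.
  by move=> [/andP[? ?]|/andP[? ?]]; [left|right].
by move=> [[? ?]|[? ?]]; [left|right]; apply/andP.
Qed.

(* Layer-cake: [|u x - u y|] is the measure of the set of levels separating
   [u x] from [u y]. *)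
Lemma mean_difference :
  \int[P \x P]_z `|u z.1 - u z.2|%:E =
  \int[lambda]_t (2 * (F t * (1 - F t)))%:E.
Proof.
have m1E : measurable_fun setT (EFin \o (\1_E : (T * T) * measurableTypeR R -> R)).
  by apply/measurable_EFinP; exact: measurable_indic.
have E0 x : 0 <= (EFin \o (\1_E : (T * T) * measurableTypeR R -> R)) x by rewrite lee_fin.
pose PP : probability (T * T)%type R := P \x P.
have := @fubini_tonelli _ _ _ _ R PP lambda _ m1E E0.
move=> fub; transitivity (\int[P \x P]_x \int[lambda]_y (\1_E (x, y))%:E).
  apply: eq_integral => -[x y] _ /=.
  rewrite (eq_integral (fun t => (\1_(xsection E (x, y)) t)%:E)); last first.
    by move=> t _; rewrite !indicE mem_xsection.
  rewrite integral_indic ?setIT//; last exact: measurable_xsection.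
  rewrite (_ : xsection E (x, y) = `[Num.min (u x) (u y), Num.max (u x) (u y)[%classic).
    rewrite [RHS](lebesgue_measure_itv `[Num.min (u x) (u y), Num.max (u x) (u y)[)/= lte_fin.
    by case: (ltgtP (u x) (u y)) => xy; rewrite ?ltxx ?xy ?subrr ?normr0//;
      [rewrite distrC|]; rewrite gtr0_norm ?subr_gt0// EFinB.
  apply/seteqP; split => t; rewrite /xsection/= inE/= in_itv/= /E/=.
    by move=> [] /andP[h1 h2]; rewrite ge_min lt_max h1 h2 ?orbT.
  by rewrite ge_min lt_max => /andP[/orP[] h1 /orP[] h2];
    [move: (le_lt_trans h1 h2); rewrite ltxx|left|right|
     move: (le_lt_trans h1 h2); rewrite ltxx] => //; apply/andP.
rewrite fub; apply: eq_integral => t _.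
rewrite (eq_integral (fun z => (\1_(ysection E t) z)%:E)); last first.
  by move=> z _; rewrite /= !indicE mem_ysection.
rewrite integral_indic ?setIT//; last exact: measurable_ysection.
pose A := [set x | u x <= t]%R.
(* At level t exactly one of the two points lies in [A]. The two rectangles are disjoint and by
   independence each has measure F (1 - F). *)
rewrite (_ : ysection E t = A `*` ~` A `|` ~` A `*` A); last first.
  apply/seteqP; split => -[x y]; rewrite /ysection/= inE/= /E/= /A/=.
    by move=> [] /andP[-> yt]; [left|right]; split => //; apply/negP; rewrite -ltNge.
  by move=> [[-> /negP]|[/negP + ->]]; rewrite -ltNge => ->; [left|right].
have mA : measurable A by exact: m_le.
have mAC : measurable (~` A) by exact: measurableC.
have PAC : P (~` A) = (1 - F t)%:E by rewrite probability_setC// PF EFinB.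
have PX B C : measurable B -> measurable C -> PP (B `*` C) = P B * P C.
  exact: product_measure1E.
transitivity (PP (A `*` ~` A `|` ~` A `*` A)) => //.
rewrite measureU; [|exact: measurableX..|].
  transitivity (P A * P (~` A) + P (~` A) * P A).
    by congr (_ + _)%E; exact: PX.
  rewrite PAC -[P A]/(P [set x | u x <= t]%R) PF.
  by rewrite -!EFinM -EFinD; congr EFin; ring.
by rewrite -subset0 => -[x y] [[/= ? ?] []].
Qed.

(** Outside [0, 1] the distribution function is 0 or 1, so F (1 - F) vanishes there. *)
Lemma mean_difference01 : P [set x | u x < 0]%R = 0 -> P [set x | u x <= 1]%R = 1 ->
  \int[P \x P]_z `|u z.1 - u z.2|%:E =
  \int[lambda]_(t in `[0%R, 1%R]) (2 * (F t * (1 - F t)))%:E.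
Proof.
move=> u0 u1; rewrite mean_difference [RHS]integral_mkcond.
apply: eq_integral => t _; rewrite patchE; case: ifPn => //.
rewrite notin_setE/= in_itv/= => /negP; rewrite negb_and -!ltNge => /orP[t0|t1].
  suff -> : F t = 0%R by rewrite mul0r mulr0.
  apply/eqP; rewrite -eqe -PF -measure_le0 -[leRHS]u0 le_measure ?inE//.
    have /(_ measurableT _ (measurable_itv `]-oo, 0%R[)) := measurable_u.
    rewrite setTI.
    by congr measurable; apply/seteqP; split => x /=; rewrite in_itv.
  by move=> x /= /le_lt_trans; exact.
suff -> : F t = 1%R by rewrite subrr !mulr0.
apply/eqP; rewrite -eqe -PF eq_le probability_le1//= -[leLHS]u1 le_measure ?inE//.
by move=> x /= /le_trans; apply; exact: ltW.
Qed.

End mean_difference.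

(** * The wedge *)

Section wedge.
Context {R : realType} (m : nat) (delta eta : R).
Hypothesis delta_itv : 0 < delta <= 1.
Hypothesis eta_itv : 0 < eta <= 1.
Local Notation V := 'rV[R]_m.+2.
Implicit Types (x y : V) (i : 'I_m.+2) (u t : R).

(** All upper bounds form one function affine in [u], so that convexity, closedness and the interior
    are treated once for all facets. *)
Definition wedge_bound u i : R :=
  if i == ord_max then eta * (2 - u) else if i == ord0 then 1 else delta * u.

Definition wedge : set V :=
  [set x | forall i, 0 <= x ord0 i <= wedge_bound (x ord0 ord0) i].

(** The values 0 and [eta] of [k] give the two large facets. A general slope lets both be treated as
    cones at once. *)
Definition wedge_sheet (k : R) : set V :=
  wedge `&` [set x | x ord0 ord_max = k * (2 - x ord0 ord0)].

Lemma wedge_bound_max u : wedge_bound u ord_max = eta * (2 - u).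
Proof. by rewrite /wedge_bound eqxx. Qed.

Lemma wedge_bound0 u : wedge_bound u ord0 = 1.
Proof. by []. Qed.

Lemma wedge_boundE u i : wedge_bound u i =
  (if i == ord_max then eta * 2 else if i == ord0 then 1 else 0) +
  (if i == ord_max then - eta else if i == ord0 then 0 else delta) * u.
Proof. by rewrite /wedge_bound; case: ifP => _; [ring|case: ifP => _; ring]. Qed.

Lemma wedge_x0 x : wedge x -> 0 <= x ord0 ord0 <= 1.
Proof. exact. Qed.

Lemma wedge_mid x i : wedge x -> i != ord_max -> i != ord0 ->
  0 <= x ord0 i <= delta * x ord0 ord0.
Proof. by move=> /(_ i); rewrite /wedge_bound => + /negPf im /negPf i0; rewrite im i0. Qed.

Lemma wedge_max x : wedge x -> 0 <= x ord0 ord_max <= eta * (2 - x ord0 ord0).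
Proof. by move=> /(_ ord_max); rewrite wedge_bound_max. Qed.

Lemma wedge_convex : convex_set wedge.
Proof.
apply/convex_setW => x y /set_mem Kx /set_mem Ky k k0 k1; apply/mem_set => i.
have {Kx}[/andP[x1 x2] {Ky}/andP[y1 y2]] := (Kx i, Ky i).
rewrite !mxE/= !wedge_boundE in x2 y2 *.
set a := k%:num in k0 k1 *; have a1 : 0 <= 1 - a by rewrite subr_ge0 ltW.
apply/andP; split; first by rewrite addr_ge0// mulr_ge0// ltW.
have := lerD (ler_wpM2l (ltW k0) x2) (ler_wpM2l a1 y2).
move/le_trans; apply; rewrite le_eqVlt; apply/orP; left; apply/eqP.
by rewrite /unstable.onem; ring.
Qed.

Lemma continuous_wedge_bound i : continuous (fun x => wedge_bound (x ord0 ord0) i).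
Proof.
rewrite (funext (fun x => wedge_boundE (x ord0 ord0) i)).
set c := (if _ then _ else _); set k := (if _ then _ else _).
have h : continuous (fun t : R => c + k * t).
  rewrite (_ : (fun _ => _) = horner (c%:P + k *: 'X)); first exact: continuous_horner.
  by apply/funext => t; rewrite !hornerE.
move=> x; apply: (@continuous_comp _ _ _ (fun x : V => x ord0 ord0) (fun t => c + k * t)).
  exact: coord_continuous.
exact: h.
Qed.

Lemma wedge_closed : closed wedge.
Proof.
rewrite (_ : wedge = \bigcap_i ([set x | 0 <= x ord0 i] `&`
    [set x | 0 <= wedge_bound (x ord0 ord0) i - x ord0 i])).
  apply: closed_bigI => i _; apply: closedI.
    apply: (@preimage_closed _ _ (fun x : V => x ord0 i) _ _ (@closed_ge R 0)).
    by move=> x _; exact: coord_continuous.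
  apply: (@preimage_closed _ _ (fun x : V => wedge_bound (x ord0 ord0) i - x ord0 i)
    _ _ (@closed_ge R 0)) => x _.
  exact: (cvgB (@continuous_wedge_bound i x) (@coord_continuous R 1 m.+2 ord0 i x)).
apply/seteqP; split => x Kx i.
  by move=> _; have /andP[? ?] := Kx i; split => //=; rewrite subr_ge0.
by have [/= -> ] := Kx i Logic.I; rewrite subr_ge0.
Qed.

Lemma wedge_compact : compact wedge.
Proof.
apply: bounded_closed_compact wedge_closed.
exists 2; split => // M M2 x Kx; rewrite /Num.norm/= mx_normrE.
apply: bigmax_le => [|[i j] _ /=]; first exact: (le_trans _ (ltW M2)).
rewrite [i]ord1; have [x1 x2] := andP (Kx j); have [u1 u2] := andP (wedge_x0 Kx).
rewrite ger0_norm// (le_trans x2)// ltW// (le_lt_trans _ M2)// /wedge_bound.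
have [[d0 d1] [e0 e1]] := (andP delta_itv, andP eta_itv).
by case: ifP => _; [|case: ifP => _]; nra.
Qed.

(** Finitely many strict inequalities between continuous functions persist in a neighbourhood. *)
Lemma wedge_interior x :
  (forall i, 0 < x ord0 i < wedge_bound (x ord0 ord0) i) -> wedge° x.
Proof.
move=> Kx; pose f i (y : V) : Prop :=
  0 < y ord0 i /\ 0 < wedge_bound (y ord0 ord0) i - y ord0 i.
have : nbhs x (fun y => forall i, f i y).
  apply: (@filter_forall _ _ f _ (nbhs_filter x)) => i; have /andP[x1 x2] := Kx i.
  have c1 := @coord_continuous R 1 m.+2 ord0 i x.
  apply: filterI; first exact: (cvgr_gt _ c1).
  have c2 := cvgB (@continuous_wedge_bound i x) c1.
  rewrite -subr_gt0 in x2; exact: (cvgr_gt _ (c2 _) _ x2).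
apply: filterS => y Ky i; have [y1] := Ky i.
by rewrite subr_gt0 => y2; rewrite !ltW.
Qed.

Lemma wedge_interior_nonempty : wedge° !=set0.
Proof.
(* The first coordinate is 1/2, its bound being 1. Hence every coordinate is half of its bound at
   this very point. *)
exists (\row_i (wedge_bound (2^-1) i / 2)); apply: wedge_interior => i.
rewrite !mxE wedge_bound0 /wedge_bound.
have [[d0 d1] [e0 e1]] := (andP delta_itv, andP eta_itv).
by case: ifP => _; [|case: ifP => _]; nra.
Qed.

Definition wedge_body : convexBody R m.+2 :=
  ConvexBody wedge_convex wedge_compact wedge_interior_nonempty.

Lemma wedge_boundaryP x : boundary wedge x -> wedge x /\
  exists i, x ord0 i = 0 \/ x ord0 i = wedge_bound (x ord0 ord0) i.
Proof.
rewrite /boundary -(closure_id wedge).1; last exact: wedge_closed.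
move=> [Kx xK]; split => //; apply: contrapT => /forallNP H; apply: xK.
apply: wedge_interior => i; have := H i; rewrite not_orP => -[/eqP x1 /eqP x2].
by have /andP[? ?] := Kx i; rewrite !lt_neqAle eq_sym x1 x2; apply/andP.
Qed.

(** Moving by e/2 up or down along the last axis stays in the wedge and does not change [u], hence
    not the bound either. *)
Lemma wedge_interior_max x : wedge° x -> 0 < x ord0 ord_max < eta * (2 - x ord0 ord0).
Proof.
move=> /nbhs_ballP[e /= e0 eK].
have H (c : R) : `|c| < e -> 0 <= x ord0 ord_max + c <= eta * (2 - x ord0 ord0).
  move=> ce; have : wedge (x + c *: delta_mx ord0 ord_max).
    apply: eK; split => // i j; rewrite /ball/= !mxE opprD addNKr normrN normrM.
    by rewrite (le_lt_trans _ ce)// ler_piMr// normr_nat; case: (_ && _).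
  by move=> /wedge_max; rewrite !mxE/= mulr0 addr0 eqxx mulr1.
have e2 : `|e / 2| < e by rewrite gtr0_norm; lra.
have /andP[_ h1] := H _ e2; rewrite -normrN in e2; have /andP[h2 _] := H _ e2.
by apply/andP; split; lra.
Qed.

Lemma wedge_sheet_boundary : wedge_sheet 0 `|` wedge_sheet eta `<=` boundary wedge.
Proof.
move=> x [] [Kx /= xm]; split; try exact: subset_closure.
  by move=> /wedge_interior_max; rewrite xm mul0r ltxx.
by move=> /wedge_interior_max; rewrite xm ltxx andbF.
Qed.

End wedge.

(** * Hausdorff measure of the boundary of the wedge *)

Section wedge_hausdorff.
Context {R : realType} (m : nat) (delta eta : R).
Hypothesis delta_itv : 0 < delta <= 1.
Hypothesis eta_itv : 0 < eta <= 1.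
Local Notation V := 'rV[R]_m.+2.
Local Notation wedge := (@wedge R m delta eta).
Local Notation sheet := (@wedge_sheet R m delta eta).
Local Notation H := (@hausdorff R m.+2 m.+1).
Implicit Types (x y : V) (i : 'I_m.+2) (k t : R).

(* The sheet [k] is a cone with this apex. *)
Let apex k : V := (2 * k) *: delta_mx ord0 ord_max.

Let homothety_apex k t x i : homothety (apex k) t x ord0 i =
  if i == ord_max then 2 * k + t * (x ord0 i - 2 * k) else t * x ord0 i.
Proof.
rewrite homothetyE !mxE eqxx /=; case: eqP => _; first by rewrite mulr1.
by rewrite mulr0 add0r subr0.
Qed.

(** Seen from the apex, all constraints on the sheet are homogeneous except u <= 1, which is assumed
    for the image. The bound [eta * (2 - u)] follows from k <= eta. *)
Lemma wedge_sheet_homothety k t x : 0 <= k <= eta -> 0 < t ->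
  sheet k x -> t * x ord0 ord0 <= 1 -> sheet k (homothety (apex k) t x).
Proof.
move=> /andP[k0 ke] t0 [Kx /= xm] tx; have [u0 u1] := andP (wedge_x0 Kx).
have tu : 0 <= t * x ord0 ord0 by rewrite mulr_ge0// ltW.
have xmE : 2 * k + t * (x ord0 ord_max - 2 * k) = k * (2 - t * x ord0 ord0).
  by rewrite xm; ring.
split; last by rewrite /= !homothety_apex eqxx.
move=> i; rewrite !homothety_apex /wedge_bound/=; case: eqP => [->|/eqP im].
  rewrite xmE; apply/andP; split; last by rewrite ler_wpM2r//; lra.
  by rewrite mulr_ge0//; lra.
case: eqP => [->|/eqP i0]; first by rewrite tu.
have /andP[x0 x1] := wedge_mid Kx im i0.
by rewrite mulr_ge0 ?(ltW t0)//= mulrCA ler_wpM2l// ltW.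
Qed.

(** The homothety of ratio [t] about the apex maps the sheet onto its part with u <= t. The
    Lipschitz estimates for it and for its inverse give the two inequalities. *)
Lemma hausdorff_wedge_sheet k t : 0 <= k <= eta -> 0 < t <= 1 ->
  H (sheet k `&` [set x | x ord0 ord0 <= t]) = ((t ^+ m.+1)%:E * H (sheet k))%E.
Proof.
move=> ke /andP[t0 t1]; have tV0 : 0 < t^-1 by rewrite invr_gt0.
apply/eqP; rewrite eq_le; apply/andP; split.
  apply: (@hausdorff_homothety _ _ _ (apex k)) => // x [Sx /= xt].
  exists (homothety (apex k) t^-1 x); last by rewrite homothetyK ?gt_eqF.
  by apply: wedge_sheet_homothety => //; rewrite mulrC ler_pdivrMr// mul1r.
have -> : (t ^+ m.+1)%:E = ((t^-1 ^+ m.+1)^-1)%:E by rewrite -exprVn invrK.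
rewrite lee_pdivrMl ?exprn_gt0//.
apply: (@hausdorff_homothety _ _ _ (apex k)) => // x Sx.
have [u0 u1] := andP (wedge_x0 Sx.1).
have tx : t * x ord0 ord0 <= t by rewrite ler_piMr// ltW.
exists (homothety (apex k) t x).
  split; first by apply: wedge_sheet_homothety => //; exact: le_trans t1.
  by rewrite /= homothety_apex.
have := @homothetyK R m.+1 (apex k) t^-1; rewrite invrK; apply.
by rewrite gt_eqF.
Qed.

Lemma measurable_wedge : measurable wedge.
Proof. by apply: measurable_closed; exact: wedge_closed. Qed.

Lemma measurable_wedge_sheet k : measurable (sheet k).
Proof.
apply: measurableI; first exact: measurable_wedge.
have mf : measurable_fun setT (fun x : V => x ord0 ord_max - k * (2 - x ord0 ord0)).
  apply: measurable_funB; first exact: measurable_coord.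
  apply: measurable_funM => //; apply: measurable_funB => //.
  exact: measurable_coord.
have := mf measurableT [set 0] (measurable_set1 0); rewrite setTI.
congr measurable; apply/seteqP; split => x /= /eqP.
  by rewrite subr_eq0 => /eqP.
by rewrite -subr_eq0 => /eqP.
Qed.

Definition wedge_sheets : set V := sheet 0 `|` sheet eta.

Lemma measurable_wedge_sheets : measurable wedge_sheets.
Proof. by apply: measurableU; exact: measurable_wedge_sheet. Qed.

(** The sheets are disjoint, as [eta * (2 - u)] is positive for u <= 1, so the scaling laws of the
    two add up. *)
Lemma hausdorff_wedge_sheets t : 0 < t <= 1 ->
  H (wedge_sheets `&` [set x | x ord0 ord0 <= t]) =
  ((t ^+ m.+1)%:E * H wedge_sheets)%E.
Proof.
move=> t01; have [e0 e1] := andP eta_itv.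
have disj : sheet 0 `&` sheet eta = set0.
  rewrite -subset0 => x [[Kx /= x0] [_ /=]]; rewrite x0; have [u0 u1] := andP (wedge_x0 Kx).
  by rewrite mul0r => /eqP; rewrite eq_sym mulf_eq0 gt_eqF//= gt_eqF//; lra.
have mt : measurable [set x : V | x ord0 ord0 <= t] by exact: measurable_coord_le.
have mS k := measurable_wedge_sheet k; have mSt k := measurableI _ _ (mS k) mt.
rewrite /wedge_sheets setIUl !measureU//; last by rewrite setIACA disj set0I.
rewrite ge0_muleDr//.
have k0 : 0 <= (0 : R) <= eta by apply/andP; split => //; exact: ltW.
have k1 : 0 <= eta <= eta by apply/andP; split => //; exact: ltW.
by congr (_ + _)%E; [exact: (hausdorff_wedge_sheet k0 t01)|exact: (hausdorff_wedge_sheet k1 t01)].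
Qed.

(* Swapping the coordinates [i] and [ord_max] lays the thin facet
   [x_i = a x_0 + c] flat, inside a slab of width [2 eta] of the flat cube. *)
Let side_map i (a c : R) (s : V) : V :=
  col_perm (tperm i ord_max) s + (a * s ord0 ord0 + c) *: delta_mx ord0 i.

(** The permutation moves each coordinate by at most |x - y|, and the slope [a] <= 1 adds at most as
    much again. This gives the 2; the other factor is the number of coordinates. *)
Let side_map_lipschitz i a c : 0 <= a <= 1 -> forall x y,
  enorm (side_map i a c x - side_map i a c y) <= (m.+2%:R * 2) * enorm (x - y).
Proof.
move=> /andP[a0 a1] x y; apply: enorm_le_coord => j.
have e0 := ler_coord_enorm (x - y) ord0.
have ej := ler_coord_enorm (x - y) (tperm i ord_max j).
rewrite (_ : _ ord0 j = (x - y) ord0 (tperm i ord_max j) +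
    a * (x - y) ord0 ord0 * (j == i)%:R); last by rewrite !mxE eqxx/=; ring.
rewrite (le_trans (ler_normD _ _))// mulrDl mul1r lerD//.
rewrite (le_trans _ e0)// !normrM mulrAC ler_piMl// normr_nat ger0_norm//.
by rewrite mulr_ile1//; case: (j == i).
Qed.

(** The erased coordinate [i] is recovered from [u] as a u + c. If [i] is the coordinate [u] itself
    this is possible only with a = 0. The last coordinate, at most 2 eta < 1/N, becomes the thin
    direction of the slab. *)
Let side_sub i a c (N : nat) x : i != ord_max -> (a == 0) || (i != ord0) ->
  (0 < N)%N -> 2 * eta * N%:R < 1 -> wedge x -> x ord0 i = a * x ord0 ord0 + c ->
  (side_map i a c @` slab i N) x.
Proof.
move=> im ai N0 eN Kx xi; have [e0 e1] := andP eta_itv; have [d0 d1] := andP delta_itv.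
have [u0 u1] := andP (wedge_x0 Kx); have [z0 z1] := andP (wedge_max Kx).
have x01 j : 0 <= x ord0 j <= 1.
  have /andP[-> xj] := Kx j; rewrite (le_trans xj)//= /wedge_bound.
  have NR0 : 0 < N%:R :> R by rewrite ltr0n.
  have NR1 : 1 <= N%:R :> R by rewrite ler1n.
  by case: ifP => _; [|case: ifP => _]; nra.
pose s := col_perm (tperm i ord_max) (x - x ord0 i *: delta_mx ord0 i).
have sE j : s ord0 j = if j == ord_max then 0 else
    if j == i then x ord0 ord_max else x ord0 j.
  rewrite !mxE eqxx/=; have [->|jm] := eqVneq j ord_max.
    by rewrite tpermR eqxx mulr1 subrr.
  have [->|ji] := eqVneq j i.
    by rewrite tpermL eq_sym (negbTE im) mulr0 subr0.
  by rewrite tpermD; [rewrite (negbTE ji) mulr0 subr0|rewrite eq_sym..].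
exists s.
  split; last first.
    rewrite /= sE (negbTE im) eqxx -[ltRHS]mul1r ltr_pdivlMr ?ltr0n//.
    by rewrite (le_lt_trans _ eN)// ler_wpM2r//; nra.
  split; first by rewrite sE eqxx.
  by move=> j; rewrite sE; case: ifP => _; [rewrite lexx ler01|case: ifP].
rewrite /side_map.
have -> : a * s ord0 ord0 + c = x ord0 i.
  rewrite xi; congr (_ + _); case/orP: ai => [/eqP->|i0]; first by rewrite !mul0r.
  by rewrite sE /= eq_sym (negbTE i0).
apply/rowP => j; rewrite mxE [col_perm _ s _ _]mxE [X in s _ X]/= sE !mxE eqxx/=.
have [->|jm] := eqVneq j ord_max.
  by rewrite tpermR (negbTE im) eqxx eq_sym (negbTE im) mulr0 addr0.
have [->|ji] := eqVneq j i; first by rewrite tpermL eqxx mulr1 add0r.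
by rewrite tpermD; [rewrite (negbTE jm) (negbTE ji) mulr0 addr0|rewrite eq_sym..].
Qed.

(** The sheet 0 contains a copy of the cube shrunk by delta/2 and pushed to u >= 1/2, where the
    middle coordinates may range up to delta/2. Enlarging this copy gives back the cube. *)
Lemma hausdorff_flat_cube :
  (H (@flat_cube R m.+1) <= ((2 / delta) ^+ m.+1)%:E * H (sheet 0))%E.
Proof.
have [[d0 d1] [e0 e1]] := (andP delta_itv, andP eta_itv).
pose v : V := 2^-1 *: delta_mx ord0 ord0.
have dV : delta / 2 * (2 / delta) = 1 by rewrite mulrA mulfVK ?divff ?gt_eqF.
apply: (@hausdorff_lipschitz _ _ _ _ _ (fun x => (2 / delta) *: (x - v))).
- by rewrite divr_gt0.
- move=> x y; rewrite -scalerBr enormZ opprB addrA subrK gtr0_norm//.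
  by rewrite divr_gt0.
move=> x [xm x01]; exists ((delta / 2) *: x + v); last first.
  by rewrite addrK scalerA mulrC dV scale1r.
have vE j : ((delta / 2) *: x + v) ord0 j =
    if j == ord0 then 2^-1 + delta / 2 * x ord0 j else delta / 2 * x ord0 j.
  by rewrite !mxE eqxx/=; case: eqP => _; rewrite ?mulr1 ?mulr0 ?addr0// addrC.
have x0 := x01 ord0.
split; last by rewrite /= vE /= xm mulr0 mul0r.
move=> j; have xj := x01 j; rewrite !vE eqxx /wedge_bound.
have dx i : 0 <= delta * x ord0 i <= 1.
  by have /andP[? ?] := x01 i; rewrite mulr_ge0 ?(ltW d0)//= mulr_ile1// ltW.
have [[h1 h2] [h3 h4]] := (andP (dx ord0), andP (dx j)); have [h5 h6] := andP x0.
have [->|jm] := eqVneq j ord_max.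
  rewrite xm /= mulr0 lexx /= mulr_ge0 ?(ltW e0)//; lra.
by have [jE|j0] := eqVneq j ord0; rewrite ?jE; apply/andP; split; nra.
Qed.

(** The constant collects 2 (m+1) facets, the Lipschitz factor of [side_map], the share 1/N of a
    slab in the cube, and the ratio of the cube to the sheet. For fixed [delta] it tends to 0 as [N]
    grows. *)
Lemma hausdorff_wedge_sides N : (0 < N)%N -> 2 * eta * N%:R < 1 ->
  (H (boundary wedge `\` wedge_sheets) <=
   (2 * m.+1%:R * (m.+2%:R * 2) ^+ m.+1 * (2 / delta) ^+ m.+1 / N%:R)%:E *
   H (sheet 0))%E.
Proof.
move=> N0 eN; have [[d0 d1] [e0 e1]] := (andP delta_itv, andP eta_itv).
have NR0 : 0 < N%:R :> R by rewrite ltr0n.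
set L := m.+2%:R * 2.
have L0 : 0 < L by rewrite mulr_gt0// ltr0n.
(* The upper facets in the form x_i = a u + c: a = 0, c = 1 for the facet u = 1, and a = delta, c =
   0 for the middle coordinates. *)
pose mid_slope i : R := if i == ord0 then 0 else delta.
pose cst i : R := if i == ord0 then 1 else 0.
pose F (k : nat) : set V := let i := inord k in
  side_map i 0 0 @` slab i N `|` side_map i (mid_slope i) (cst i) @` slab i N.
have sub : boundary wedge `\` wedge_sheets `<=` \big[setU/set0]_(k < m.+1) F k.
  move=> x [/wedge_boundaryP[Kx [i xi]] xS].
  have im : i != ord_max.
    apply: contra_notN xS => /eqP im; rewrite im wedge_bound_max in xi.
    by case: xi => xi; [left|right]; split => //=; rewrite mul0r.
  have ilt : (i < m.+1)%N.
    by rewrite ltn_neqAle -ltnS ltn_ord andbT.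
  rewrite -(bigcup_mkord _ F); exists (nat_of_ord i) => //; rewrite /F inord_val.
  case: xi => xi; [left|right]; apply: side_sub => //.
  - by rewrite eqxx.
  - by rewrite mul0r addr0.
  - by rewrite /mid_slope; case: (i == ord0); rewrite ?eqxx ?orbT.
  - rewrite xi /wedge_bound (negbTE im) /mid_slope /cst.
    by case: ifP => _; rewrite ?mul0r ?add0r ?addr0.
have slabE i : i != ord_max -> (H (slab i N) <= (N%:R^-1)%:E * H (@flat_cube R m.+1))%E.
  by move=> im; rewrite lee_pdivlMl//; exact: hausdorff_slab.
have side i a c : i != ord_max -> 0 <= a <= 1 ->
    (H (side_map i a c @` slab i N) <=
     (L ^+ m.+1 / N%:R)%:E * H (@flat_cube R m.+1))%E.
  move=> im a01; apply: (@le_trans _ _ ((L ^+ m.+1)%:E * H (slab i N))%E).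
    by apply: (@hausdorff_lipschitz _ _ _ _ L (side_map i a c)) => //; exact: side_map_lipschitz.
  rewrite EFinM -muleA; apply: lee_wpmul2l; last exact: slabE.
  by rewrite lee_fin exprn_ge0// ltW.
apply: (le_trans (le_outer_measure H _ _ sub)).
apply: (le_trans (outer_measure_subadditive H F m.+1)).
apply: (@le_trans _ _ (\sum_(k < m.+1)
    (2 * (L ^+ m.+1 / N%:R))%:E * H (@flat_cube R m.+1))%E).
  apply: lee_sum => k _; apply: (le_trans (outer_measureU2 H _ _)).
  rewrite mulr_natl mulr2n EFinD ge0_muleDl; last 2 first.
  - by rewrite lee_fin divr_ge0// exprn_ge0// ltW.
  - by rewrite lee_fin divr_ge0// exprn_ge0// ltW.
  have im : (inord k : 'I_m.+2) != ord_max.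
    by rewrite -val_eqE/= inordK ?(ltn_trans (ltn_ord k))// neq_ltn ltn_ord.
  apply: leeD; apply: side => //; first by apply/andP.
  by rewrite /mid_slope; case: ifP => _; [apply/andP|apply/andP; split => //; exact: ltW].
set X := ((2 * (L ^+ m.+1 / N%:R))%:E * _)%E.
have -> : (\sum_(k < m.+1) X = m.+1%:R%:E * X)%E.
  by rewrite sumr_const card_ord mule_natl.
rewrite {}/X muleA -EFinM.
have C0 : 0 <= m.+1%:R * (2 * (L ^+ m.+1 / N%:R)).
  by rewrite mulr_ge0// mulr_ge0// divr_ge0// exprn_ge0// ltW.
rewrite -lee_fin in C0; apply: (le_trans (lee_wpmul2l C0 hausdorff_flat_cube)).
rewrite muleA -EFinM le_eqVlt; apply/orP; left; apply/eqP; congr (_%:E * _)%E.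
by set a := L ^+ _; set b := (_ / delta) ^+ _; ring.
Qed.

End wedge_hausdorff.

(** * Volume of the wedge *)

Section lebesgue_wedge.
Context {R : realType}.

Lemma deriv_scaleXn (c : R) n :
  (c *: 'X^(n.+1))^`() = (c * n.+1%:R) *: 'X^n :> {poly R}.
Proof. by rewrite derivZ derivXn -scaler_nat scalerA. Qed.

Lemma lebesgue_rV_box n (c : 'I_n -> R) : (forall i, 0 <= c i) ->
  lebesgue_rV [set y : 'rV[R]_n | forall i, 0 <= y ord0 i <= c i] =
  (\prod_(i < n) c i)%:E.
Proof.
elim: n c => [|n IH] c c0.
  rewrite big_ord0 /= diracE mem_set// => i.
  by case: i.
pose B := [set y : 'rV[R]_n | forall i, 0 <= y ord0 i <= c (lift ord0 i)].
have mB : measurable B.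
  rewrite (_ : B = \bigcap_(i in [set: 'I_n])
      [set y : 'rV[R]_n | y ord0 i \in `[0, c (lift ord0 i)]]).
    by apply: fin_bigcap_measurable => // i _; exact: measurable_coord_itv.
  apply/seteqP; split => y By i; first by move=> _; rewrite /= in_itv/=.
  by have := By i Logic.I; rewrite /= in_itv.
transitivity ((@lebesgue_measure R \x @lebesgue_rV R n)%E (`[0, c ord0]%classic `*` B)).
  congr ((_ \x _)%E _); apply/seteqP; split => -[u y] /=.
    move=> H; split; first by have := H ord0; rewrite consV0 in_itv.
    by move=> i; have := H (lift ord0 i); rewrite consVS.
  rewrite in_itv/= => -[u0 By] i; case: (unliftP ord0 i) => [j|] ->.
    by rewrite consVS; exact: By.
  by rewrite consV0.
rewrite product_measure1E// [X in (X * _)%E]lebesgue_measure_itv/= lte_fin.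
rewrite [X in (_ * X)%E](IH (fun i => c (lift ord0 i))) // big_ord_recl EFinM oppr0 adde0.
case: ltP => // c00; suff -> : c ord0 = 0 by [].
by apply/eqP; rewrite eq_le c00 c0.
Qed.

(** The section at [u] is a box with [m] sides delta u and one side eta (2 - u). Its volume is a
    polynomial in [u], integrated through the antiderivative [q]. *)
Lemma lebesgue_wedge m (delta eta t : R) : 0 <= delta -> 0 <= eta -> 0 <= t <= 1 ->
  lebesgue_rV (@wedge R m delta eta `&` [set x | x ord0 ord0 <= t]) =
  (delta ^+ m * eta * (2 / m.+1%:R * t ^+ m.+1 - m.+2%:R^-1 * t ^+ m.+2))%:E.
Proof.
move=> d0 e0 /andP[t0 t1].
pose A : set (R * 'rV[R]_m.+1) := (@consV R m.+1) @^-1`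
  (@wedge R m delta eta `&` [set x | x ord0 ord0 <= t]).
transitivity ((@lebesgue_measure R \x @lebesgue_rV R m.+1)%E A) => //.
pose q : {poly R} := (delta ^+ m * eta) *:
  ((2 / m.+1%:R) *: 'X^(m.+1) - m.+2%:R^-1 *: 'X^(m.+2)).
have qE u : q.[u] = delta ^+ m * eta *
    (2 / m.+1%:R * u ^+ m.+1 - m.+2%:R^-1 * u ^+ m.+2).
  by rewrite /q !hornerE.
rewrite -qE -[q.[t]]subr0 -[X in _ - X](_ : q.[0] = 0); last first.
  by rewrite qE !expr0n !mulr0 subrr mulr0.
rewrite -integral_deriv_horner// [RHS]integral_mkcond.
(* The product measure is by definition the integral of the measures of the sections, so the
   integrands are compared for each [u]; outside [0, t] the section is empty. *)
apply: eq_integral => u _; rewrite patchE /=.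
have q'E : q^`().[u] = delta ^+ m * eta * (u ^+ m * (2 - u)).
  rewrite /q derivZ derivB !deriv_scaleXn divfK ?pnatr_eq0// mulVf ?pnatr_eq0//.
  by rewrite hornerZ hornerD hornerN !hornerZ !hornerXn exprS; ring.
rewrite q'E.
case: ifPn => [/set_mem|/negP ut].
  rewrite /= in_itv/= => /andP[u0 ut].
  rewrite (_ : xsection A u = [set y : 'rV[R]_m.+1 | forall i : 'I_m.+1,
      0 <= y ord0 i <= wedge_bound delta eta u (lift ord0 i)]).
    have b0 (i : 'I_m.+1) : 0 <= wedge_bound delta eta u (lift ord0 i).
      rewrite /wedge_bound/=; case: ifP => _; last by rewrite mulr_ge0.
      by rewrite mulr_ge0//; lra.
    rewrite [LHS](lebesgue_rV_box b0) big_ord_recr/=.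
    rewrite (_ : lift ord0 ord_max = ord_max); last exact: val_inj.
    rewrite wedge_bound_max (eq_bigr (fun=> delta * u)); last first.
      move=> i _; rewrite /wedge_bound/= -val_eqE/= /bump/=.
      by rewrite eqn_leq andbC leqNgt !ltnS ltn_ord.
    by rewrite prodr_const card_ord exprMn; congr (_%:E); ring.
  rewrite /xsection; apply/seteqP; split => y /=; rewrite inE /A/=.
    by move=> [Ky _] i; have := Ky (lift ord0 i); rewrite consVS consV0.
  rewrite consV0/= => Ky; split => // i; case: (unliftP ord0 i) => [j|] ->.
    by rewrite consVS consV0.
  by rewrite consV0 wedge_bound0 u0/= (le_trans ut).
rewrite (_ : xsection A u = set0); first exact: (measure0 (@lebesgue_rV R m.+1)).
rewrite -subset0 /xsection => y /=; rewrite inE /A/= => -[/(_ ord0)].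
rewrite consV0 /= => /andP[u0 _] ut'; apply: ut; apply/mem_set.
by rewrite /= in_itv/= u0.
Qed.

End lebesgue_wedge.

(** * Comparison of mean distances *)

Section gini.
Context {R : realType}.
Local Notation mu := (@lebesgue_measure R).

(** Two monomials cover both laws: the volume needs both, the sheets correspond to a = 1 and b = 0.
    The polynomial [q] is the antiderivative of 2 f (1 - f) vanishing at 0. *)
Lemma integral_gini (a b : R) (n : nat) (f : R -> R) :
  (forall t, f t = a * t ^+ n - b * t ^+ n.+1) ->
  (\int[mu]_(t in `[0%R, 1%R]) (2 * (f t * (1 - f t)))%:E =
   (2 * (a / n.+1%:R - b / n.+2%:R - a ^+ 2 / (n + n).+1%:R +
         2 * a * b / (n + n).+2%:R - b ^+ 2 / (n + n).+3%:R))%:E)%E.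
Proof.
move=> fE; pose q : {poly R} := 2 *: ((a / n.+1%:R) *: 'X^(n.+1)
  - (b / n.+2%:R) *: 'X^(n.+2) - (a ^+ 2 / (n + n).+1%:R) *: 'X^((n + n).+1)
  + (2 * a * b / (n + n).+2%:R) *: 'X^((n + n).+2)
  - (b ^+ 2 / (n + n).+3%:R) *: 'X^((n + n).+3)).
have qE t : q.[t] = 2 * (a / n.+1%:R * t ^+ n.+1 - b / n.+2%:R * t ^+ n.+2
    - a ^+ 2 / (n + n).+1%:R * t ^+ (n + n).+1
    + 2 * a * b / (n + n).+2%:R * t ^+ (n + n).+2
    - b ^+ 2 / (n + n).+3%:R * t ^+ (n + n).+3).
  by rewrite /q !(hornerZ, hornerD, hornerN, hornerXn).
have q'E t : q^`().[t] = 2 * (f t * (1 - f t)).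
  rewrite /q derivZ !derivB derivD !derivB !deriv_scaleXn !divfK ?pnatr_eq0//.
  rewrite !(hornerZ, hornerD, hornerN, hornerXn) fE !exprS exprD.
  by ring.
transitivity (\int[mu]_(t in `[0%R, 1%R]) (q^`().[t])%:E)%E.
  by apply: eq_integral => t _; rewrite q'E.
rewrite integral_deriv_horner ?ler01// !qE !expr1n !expr0n /=.
by congr (_%:E); ring.
Qed.

End gini.

(** * Bounds for mean distances, and uniform laws *)

Section mean_distance.
Context {R : realType} (n : nat) (P : probability 'rV[R]_n R).
Local Open Scope ereal_scope.
Local Notation V := 'rV[R]_n.

Let measurable_coord_sub i :
  measurable_fun setT (fun z : V * V => z.1 ord0 i - z.2 ord0 i)%R.
Proof.
have m1 := measurableT_comp (@measurable_coord R n i) (@measurable_fst _ _ V V).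
have m2 := measurableT_comp (@measurable_coord R n i) (@measurable_snd _ _ V V).
exact: measurable_funB m1 m2.
Qed.

Lemma measurable_enorm_sub :
  measurable_fun setT (fun z : V * V => enorm (z.1 - z.2)).
Proof.
have ms := continuous_measurable_fun (@sqrt_continuous R).
apply: (measurableT_comp ms).
apply: measurable_sum => i; apply: measurable_funX.
rewrite (_ : (fun _ => _) = (fun z : V * V => z.1 ord0 i - z.2 ord0 i)%R) //.
by apply/funext => z; rewrite !mxE.
Qed.

Lemma mean_distanceE :
  mean_distance P = \int[P \x P]_z (enorm (z.1 - z.2))%:E.
Proof. by rewrite /mean_distance unlock. Qed.

Let PX A B : measurable A -> measurable B -> (P \x P) (A `*` B) = P A * P B.
Proof. exact: product_measure1E. Qed.

(** The product law is concentrated on the square of [D], so a bound valid there holds almost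
    everywhere. *)
Lemma mean_distance_le (D : set V) (g : V * V -> R) :
  measurable D -> P D = 1 -> measurable_fun setT g -> (forall z, 0 <= g z)%R ->
  (forall x y, D x -> D y -> enorm (x - y) <= g (x, y))%R ->
  mean_distance P <= \int[P \x P]_z (g z)%:E.
Proof.
move=> mD PD mg g0 Dg; rewrite mean_distanceE.
apply: ae_ge0_le_integral => //.
- by move=> z _; rewrite lee_fin sqrtr_ge0.
- by apply/measurable_EFinP; exact: measurable_enorm_sub.
- by move=> z _; rewrite lee_fin.
- exact/measurable_EFinP.
pose PP : probability (V * V)%type R := P \x P.
have mDD : measurable (D `*` D) by exact: measurableX.
exists (~` (D `*` D)); split; first exact: measurableC.
  transitivity (PP (~` (D `*` D))) => //.
  rewrite probability_setC// [X in _ - X](_ : _ = 1) ?subee//.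
  by transitivity (P D * P D); [exact: PX|rewrite PD mule1].
move=> z /= Hz [Dx Dy]; apply: Hz => _; rewrite lee_fin.
by case: z Dx Dy => x y; exact: Dg.
Qed.

Lemma le_mean_distance (i : 'I_n) :
  \int[P \x P]_z `|z.1 ord0 i - z.2 ord0 i|%:E <= mean_distance P.
Proof.
rewrite mean_distanceE; apply: ge0_le_integral => //.
- apply/measurable_EFinP.
  exact: (measurableT_comp (@normr_measurable R setT) (measurable_coord_sub i)).
- by apply/measurable_EFinP; exact: measurable_enorm_sub.
move=> z _; rewrite lee_fin; have := ler_coord_enorm (z.1 - z.2) i.
by rewrite !mxE.
Qed.

End mean_distance.

Section uniform_on.
Context {R : realType} (n : nat) (mu : {measure set 'rV[R]_n -> \bar R}).
Variables (D : set 'rV[R]_n) (mD : measurable D).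
Local Open Scope ereal_scope.

Let mrestrT : mrestr mu mD setT = mu D.
Proof. by congr (mu _); rewrite setTI. Qed.

Lemma uniform_onE (A : set 'rV[R]_n) : 0 < mu D < +oo ->
  uniform_on mu mD A = mu (A `&` D) * (fine (mu D))^-1%:E.
Proof.
(* The case distinction of [mnormalize] is stated for a generic [c], so that the total mass of the
   restriction is identified with [mu D] by conversion. *)
move=> /andP[D0 Doo]; have E (c : \bar R) : c = mu D ->
    (if (c == 0) || (c == +oo) then \d_(0%R : 'rV[R]_n) : set _ -> \bar R
     else fun U => mrestr mu mD U * (fine c)^-1%:E) A =
    mu (A `&` D) * (fine (mu D))^-1%:E.
  by move=> ->; rewrite gt_eqF//= lt_eqF.
exact: E mrestrT.
Qed.

(** In the degenerate cases the law is the default Dirac mass at 0, concentrated on a single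
    point. *)
Lemma uniform_on_degenerate : ~~ (0 < mu D < +oo) -> mean_distance (uniform_on mu mD) <= 0.
Proof.
move=> D0; have m0 : measurable [set (0%R : 'rV[R]_n)].
  by apply: measurable_closed; apply: compact_closed; [exact: norm_hausdorff|exact: compact_set1].
have -> : 0 = \int[uniform_on mu mD \x uniform_on mu mD]_z ((fun=> 0%R) z)%:E.
  by rewrite integral0.
apply: (mean_distance_le m0) => //.
  have : (mu D == 0) || (mu D == +oo).
    by move: D0; rewrite lt0e measure_ge0 andbT ltey -negb_or negbK.
  move=> Doo; have E (c : \bar R) : c = mu D ->
    (if (c == 0) || (c == +oo) then \d_(0%R : 'rV[R]_n) : set _ -> \bar R
     else fun U => mrestr mu mD U * (fine c)^-1%:E) [set 0%R] = 1.
    by move=> ->; rewrite Doo diracE mem_set.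
  exact: E mrestrT.
by move=> x y /= -> ->; rewrite subrr enorm0.
Qed.

End uniform_on.

(** * Lower bound for the mean distance in the wedge *)

Section wedge_mean_distance.
Context {R : realType} (m : nat) (delta eta : R).
Hypothesis delta_itv : 0 < delta <= 1.
Hypothesis eta_itv : 0 < eta <= 1.
Local Notation V := 'rV[R]_m.+2.
Local Notation wedge := (@wedge R m delta eta).
Local Notation K := (@wedge_body R m delta eta delta_itv eta_itv).

Lemma wedge_x0_uniform (mu : {measure set V -> \bar R}) (D : set V)
    (mD : measurable D) : D `<=` wedge -> (0 < mu D < +oo)%E ->
  [/\ uniform_on mu mD D = 1%E,
      uniform_on mu mD [set x : V | x ord0 ord0 < 0] = 0%E &
      uniform_on mu mD [set x : V | x ord0 ord0 <= 1] = 1%E].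
Proof.
move=> DK D0; have PD : uniform_on mu mD D = 1%E.
  rewrite uniform_onE// setIid; have /andP[D00 Doo] := D0.
  have fD : mu D \is a fin_num by rewrite ge0_fin_numE.
  by rewrite -{1}(fineK fD) -EFinM divff// fine_eq0// gt_eqF.
split=> //.
- rewrite uniform_onE// (_ : _ `&` _ = set0) ?measure0 ?mul0e//.
  rewrite -subset0 => x [/= x0 /DK/wedge_x0/andP[]].
  by rewrite leNgt x0.
- rewrite -[RHS]PD !uniform_onE// setIid (_ : _ `&` _ = D)//.
  by apply/seteqP; split => [x []//|x Dx]; split => //=; have /andP[] := wedge_x0 (DK _ Dx).
Qed.

(** Distances are bounded below by differences of [u]. The value is the exact mean difference of [u]
    under the volume, the same for all [delta] and [eta]. *)
Lemma le_Delta_wedge (n := m.+1%:R : R) :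
  ((2 * n * (2 * n + 9) * (n + 1) /
    ((n + 2) ^+ 2 * (2 * n + 1) * (2 * n + 3)))%:E <= Delta K)%E.
Proof.
have [[d0 d1] [e0 e1]] := (andP delta_itv, andP eta_itv).
have n0 : 0 < n by rewrite ltr0n.
have nS1 : m.+2%:R = n + 1 :> R by rewrite -natr1.
pose c := delta ^+ m * eta; have c0 : 0 < c by rewrite mulr_gt0// exprn_gt0.
have volE t : 0 <= t <= 1 ->
    lebesgue_rV (wedge `&` [set x : V | x ord0 ord0 <= t]) =
    (c * (2 / n * t ^+ m.+1 - (n + 1)^-1 * t ^+ m.+2))%:E.
  by move=> t01; rewrite lebesgue_wedge ?nS1// ltW.
(* The volume is c z. The factor [c], which carries [delta] and [eta], cancels on normalizing. *)
pose z : R := 2 / n - (n + 1)^-1.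
have zE : z = (n + 2) / (n * (n + 1)).
  by rewrite /z; field; rewrite ?gt_eqF//; lra.
have z0 : 0 < z by rewrite zE divr_gt0 ?mulr_gt0//; lra.
have volK : lebesgue_rV wedge = (c * z)%:E.
  rewrite (_ : wedge = wedge `&` [set x : V | x ord0 ord0 <= 1]).
    by rewrite volE ?ler01 ?lexx// !expr1n !mulr1.
  apply/seteqP; split => [x Kx|x []//]; split => //=.
  by have /andP[] := wedge_x0 Kx.
have K0 : (0 < lebesgue_rV (K : set V) < +oo)%E.
  by rewrite [lebesgue_rV _]volK lte_fin mulr_gt0//= ltry.
have [PK P0 P1] := wedge_x0_uniform (measurable_body K) (@subset_refl _ _) K0.
rewrite /Delta; set P := uniform_on _ _ in PK P0 P1 *.
apply: le_trans (le_mean_distance P ord0).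
rewrite (mean_difference01 (@measurable_coord R m.+2 ord0) P0 P1).
have fK : fine (lebesgue_rV (K : set V)) = c * z by rewrite [lebesgue_rV _]volK.
(* [f] integrates the normalized density of [u], proportional to [u^(n-1) (2 - u)]. *)
pose a : R := 2 * (n + 1) / (n + 2); pose b : R := n / (n + 2).
pose f (t : R) := a * t ^+ m.+1 - b * t ^+ m.+2.
pose F t := fine (P [set x : V | x ord0 ord0 <= t]).
have -> : (\int[lebesgue_measure]_(t in `[0%R, 1%R]) (2 * (F t * (1 - F t)))%:E =
           \int[lebesgue_measure]_(t in `[0%R, 1%R]) (2 * (f t * (1 - f t)))%:E)%E.
  apply: eq_integral => t /set_mem; rewrite /F /= in_itv/= => t01.
  suff -> : P [set x : V | x ord0 ord0 <= t] = (f t)%:E by [].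
  rewrite /P uniform_onE// setIC [X in (X * _)%E]volE// [fine _]fK.
  rewrite -EFinM /f /a /b zE; congr EFin; field.
  by rewrite ?gt_eqF ?andbT//; lra.
rewrite (integral_gini (a := a) (b := b) (n := m.+1)) // lee_fin.
rewrite nS1 -[m.+3%:R]natr1 nS1.
have nn1 : (m.+1 + m.+1).+1%:R = 2 * n + 1 :> R by rewrite -natr1 natrD -/n; ring.
rewrite -[(m.+1 + m.+1).+3%:R]natr1 -[(m.+1 + m.+1).+2%:R]natr1 nn1.
rewrite le_eqVlt; apply/orP; left; apply/eqP.
rewrite /a /b; field.
by rewrite ?gt_eqF ?andbT//; lra.
Qed.

End wedge_mean_distance.

(** * Upper bound for the mean distance on the boundary *)

Section wedge_surface_distance.
Context {R : realType} (m : nat) (delta eta : R) (N : nat).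
Hypothesis delta_itv : 0 < delta <= 1.
Hypothesis eta_itv : 0 < eta <= 1.
Hypothesis N0 : (0 < N)%N.
Hypothesis etaN : 2 * eta * N%:R < 1.
Local Notation V := 'rV[R]_m.+2.
Local Notation wedge := (@wedge R m delta eta).
Local Notation sheets := (@wedge_sheets R m delta eta).
Local Notation K := (@wedge_body R m delta eta delta_itv eta_itv).
Local Notation H := (@hausdorff R m.+2 m.+1).
Local Notation B := (boundary wedge).

Definition wedge_side_ratio : R :=
  2 * m.+1%:R * (m.+2%:R * 2) ^+ m.+1 * (2 / delta) ^+ m.+1 / N%:R.

Lemma wedge_side_ratio_ge0 : 0 <= wedge_side_ratio.
Proof.
have /andP[/ltW d0 _] := delta_itv.
by rewrite divr_ge0// !mulr_ge0// ?exprn_ge0// ?divr_ge0// mulr_ge0.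
Qed.

(** Both points have all coordinates other than [u] in [0, delta + 2 eta], and the Euclidean norm is
    at most the sum norm. *)
Lemma wedge_enorm_sub (x y : V) : wedge x -> wedge y ->
  enorm (x - y) <= `|x ord0 ord0 - y ord0 ord0| + m.+1%:R * (delta + 2 * eta).
Proof.
move=> Kx Ky; have [[d0 d1] [e0 e1]] := (andP delta_itv, andP eta_itv).
apply: (le_trans (enorm_le_sum _)); rewrite big_ord_recl !mxE lerD2l.
rewrite -[m.+1 in leRHS]card_ord mulr_natl -sumr_const; apply: ler_sum => i _.
rewrite !mxE; set j := lift ord0 i.
have [x1 x2] := andP (Kx j); have [y1 y2] := andP (Ky j).
have [u0 u1] := andP (wedge_x0 Kx); have [v0 v1] := andP (wedge_x0 Ky).
have bj u : 0 <= u <= 1 -> wedge_bound delta eta u j <= delta + 2 * eta.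
  by move=> /andP[? ?]; rewrite /wedge_bound /=; case: ifP => _; nra.
have := bj _ (wedge_x0 Kx); have := bj _ (wedge_x0 Ky).
by rewrite ler_norml; lra.
Qed.

Section cdf.
Hypothesis B0 : (0 < H B < +oo)%E.

Let P := uniform_on H (measurable_boundary wedge).

(** On the sheets the proportion with u <= t is exactly t^(m+1), so only the sides, whose share is
    at most [wedge_side_ratio], can disturb it. *)
Lemma wedge_surface_cdf t : 0 < t <= 1 ->
  `|fine (P [set x : V | x ord0 ord0 <= t]) - t ^+ m.+1| <= wedge_side_ratio.
Proof.
move=> t01; have [t0 t1] := andP t01; have [HB0 HBoo] := andP B0.
have tn0 : 0 <= t ^+ m.+1 by rewrite exprn_ge0// ltW.
have tn1 : t ^+ m.+1 <= 1 by rewrite exprn_ile1// ltW.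
have mB : measurable B by exact: measurable_boundary.
have mS : measurable sheets by exact: measurable_wedge_sheets.
have SB : sheets `<=` B by exact: wedge_sheet_boundary.
have Hfin A : A `<=` B -> H A \is a fin_num.
  move=> AB; rewrite ge0_fin_numE ?outer_measure_ge0//.
  exact: le_lt_trans (le_outer_measure H _ _ AB) HBoo.
have HE A : measurable A -> H A = (H (A `\` sheets) + H (A `&` sheets))%E.
  by move=> mA; rewrite -measureDI.
have sides := hausdorff_wedge_sides m delta_itv eta_itv N0 etaN.
have S0S : (H (wedge_sheet delta eta 0) <= H sheets)%E.
  by apply: (le_outer_measure H) => x; left.
pose A := [set x : V | x ord0 ord0 <= t] `&` B.
have mA : measurable A by apply: measurableI => //; exact: measurable_coord_le.
have AS : A `&` sheets = sheets `&` [set x : V | x ord0 ord0 <= t].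
  apply/seteqP; split => x; first by move=> [[]].
  by move=> [Sx tx]; split => //; split => //; exact: SB.
have HA := HE _ mA; rewrite AS (hausdorff_wedge_sheets m delta eta_itv t01) in HA.
have HBE := HE _ mB; rewrite (setIidr SB) in HBE.
have lsub : (H (A `\` sheets) <= H (B `\` sheets))%E.
  by apply: (le_outer_measure H) => x [[_ ?] ?].
have fS := Hfin _ SB.
have fL : H (B `\` sheets) \is a fin_num by apply: Hfin => x [].
have fl : H (A `\` sheets) \is a fin_num by apply: Hfin => x [[]].
have l0 : (0 <= H (A `\` sheets))%E by exact: outer_measure_ge0.
have r0 := wedge_side_ratio_ge0.
have S0r : (H (B `\` sheets) <= wedge_side_ratio%:E * H sheets)%E.
  by apply: (le_trans sides); rewrite lee_wpmul2l ?lee_fin.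
have -> : P [set x : V | x ord0 ord0 <= t] = (H A * (fine (H B))^-1%:E)%E.
  exact: uniform_onE.
rewrite HA HBE.
rewrite HBE in HB0.
move: l0 lsub S0r HB0; rewrite -(fineK fS) -(fineK fL) -(fineK fl) /=.
set s := fine (H sheets); set L := fine (H (B `\` _)); set l := fine (H (A `\` _)).
rewrite -EFinM -!EFinD !lee_fin lte_fin => l0 lL Lr sL0.
(* Both l and t^(m+1) L lie between 0 and L, and L <= r s <= r (L + s), with r the side ratio. *)
have -> : (l + t ^+ m.+1 * s) / (L + s) - t ^+ m.+1 =
    (l - t ^+ m.+1 * L) / (L + s) by field; rewrite gt_eqF.
have L0 := le_trans l0 lL.
rewrite normrM normfV (gtr0_norm sL0) ler_pdivrMr// ler_norml.
by apply/andP; split; nra.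
Qed.

End cdf.

(** The three terms are the mean difference for the distribution function t^n, the error due to the
    sides, and the error of replacing distances by differences of [u]. *)
Lemma theta_wedge_le (n := m.+1%:R : R) :
  (theta K <= (2 * n / ((n + 1) * (2 * n + 1)) + 2 * wedge_side_ratio +
    n * (delta + 2 * eta))%:E)%E.
Proof.
have [[d0 d1] [e0 e1]] := (andP delta_itv, andP eta_itv).
have r0 := wedge_side_ratio_ge0; have n0 : 0 < n by rewrite ltr0n.
set k := n * (delta + 2 * eta); have k0 : 0 <= k by rewrite mulr_ge0//; lra.
have [B0|B0] := boolP (0 < H B < +oo)%E; last first.
  apply: (le_trans (uniform_on_degenerate _ B0)); rewrite lee_fin !addr_ge0//.
  - by rewrite divr_ge0// mulr_ge0//; lra.
  - by rewrite mulr_ge0.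
have BK : B `<=` wedge by move=> x /wedge_boundaryP[].
have [PB P0 P1] := wedge_x0_uniform (measurable_boundary wedge) BK B0.
have Pcdf := wedge_surface_cdf B0.
rewrite /theta; set P := uniform_on _ _ in PB P0 P1 Pcdf *.
pose g (z : V * V) := `|z.1 ord0 ord0 - z.2 ord0 ord0| + k.
have m1 : measurable_fun setT (fun z : V * V => `|z.1 ord0 ord0 - z.2 ord0 ord0|).
  have h1 := measurableT_comp (@measurable_coord R m.+2 ord0) (@measurable_fst _ _ V V).
  have h2 := measurableT_comp (@measurable_coord R m.+2 ord0) (@measurable_snd _ _ V V).
  exact: (measurableT_comp (@normr_measurable R setT) (measurable_funB h1 h2)).
have mg : measurable_fun setT g by apply: measurable_funD.
apply: (@le_trans _ _ (\int[P \x P]_z (g z)%:E)%E).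
  apply: (mean_distance_le (measurable_boundary wedge)) => //.
    by move=> z; rewrite /g addr_ge0.
  by move=> x y /BK Kx /BK Ky; rewrite /g; exact: wedge_enorm_sub.
have -> : (\int[P \x P]_z (g z)%:E = \int[P \x P]_z `|z.1 ord0 ord0 - z.2 ord0 ord0|%:E + k%:E)%E.
  under eq_integral do rewrite /g EFinD.
  rewrite ge0_integralD//; last exact/measurable_EFinP.
  congr (_ + _)%E; rewrite integral_cst// [X in (_ * X)%E](_ : _ = 1%E) ?mule1//.
  exact: (@probability_setT _ _ _ (P \x P)%E).
rewrite [leRHS]EFinD leeD2r// (mean_difference01 (@measurable_coord R m.+2 ord0) P0 P1).
pose F t := fine (P [set x : V | x ord0 ord0 <= t]).
have mF : measurable_fun setT F.
  exact: (measurable_cdf_fine P (@measurable_coord R m.+2 ord0)).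
have mFF : measurable_fun setT (fun t => 2 * (F t * (1 - F t))).
  by apply: measurable_funM => //; apply: measurable_funM => //; exact: measurable_funB.
(* The vanishing second coefficient puts t^n in the form required by [integral_gini]. *)
pose h (t : R) : R := 1 * t ^+ m.+1 - 0 * t ^+ m.+2.
have hE t : h t = t ^+ m.+1 by rewrite /h mul1r mul0r subr0.
have mh : measurable_fun setT (fun t => 2 * (h t * (1 - h t))).
  rewrite (_ : h = fun t => t ^+ m.+1); last exact/funext.
  apply: measurable_funM => //; apply: measurable_funM; first exact: measurable_funX.
  by apply: measurable_funB => //; exact: measurable_funX.
have F01 t : 0 <= F t <= 1.
  exact: (cdf_fine_itv P (@measurable_coord R m.+2 ord0)).
have h01 t : 0 <= t <= 1 -> 0 <= h t <= 1.
  by move=> /andP[? ?]; rewrite hE exprn_ge0//= exprn_ile1.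
apply: (@le_trans _ _ (\int[lebesgue_measure]_(t in `[0%R, 1%R])
    (2 * (h t * (1 - h t)) + 2 * wedge_side_ratio)%:E)%E).
  (* The endpoint 0, a null set, is dropped because the estimate of the distribution function is
     available for t > 0. *)
  rewrite -!integral_itv_obnd_cbnd; last 2 first.
  - exact/measurable_funTS/measurable_EFinP/measurable_funD.
  - exact/measurable_funTS/measurable_EFinP.
  apply: ge0_le_integral => //.
  - move=> t _; have /andP[? ?] := F01 t.
    by rewrite lee_fin mulr_ge0// mulr_ge0// subr_ge0.
  - exact/measurable_funTS/measurable_EFinP.
  - exact/measurable_funTS/measurable_EFinP/measurable_funD.
  move=> t; rewrite /= in_itv/= => t01; rewrite lee_fin.
  (* The function 2 x (1 - x) is Lipschitz with constant 2 on [0, 1]. *)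
  have := Pcdf t t01; rewrite -/(F t) -hE ler_norml.
  have /andP[t0 t1] := t01; have /andP[h0 h1] : 0 <= h t <= 1 by apply: h01; rewrite ltW.
  have /andP[f0 f1] := F01 t; move=> /andP[c1 c2]; nra.
under eq_integral do rewrite EFinD.
rewrite ge0_integralD//; last 3 first.
- move=> t; rewrite /= in_itv/= => /h01/andP[? ?].
  by rewrite lee_fin mulr_ge0// mulr_ge0// subr_ge0.
- exact/measurable_funTS/measurable_EFinP.
- by move=> t _; rewrite lee_fin mulr_ge0.
have l1 : lebesgue_measure (`[0%R, 1%R]%classic : set R) = 1%E.
  by rewrite lebesgue_measure_itv/= lte_fin ltr01 oppr0 adde0.
rewrite (integral_gini (a := 1) (b := 0) (n := m.+1)) // integral_cst//.
rewrite [X in (_ * X)%E]l1 mule1 EFinD leeD2r// lee_fin.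
have nS1 : m.+2%:R = n + 1 :> R by rewrite -natr1.
have nn1 : (m.+1 + m.+1).+1%:R = 2 * n + 1 :> R by rewrite -natr1 natrD -/n; ring.
rewrite nS1 nn1 !mulr0 expr0n /= !mul0r expr1n.
rewrite le_eqVlt; apply/orP; left; apply/eqP; field.
by rewrite ?gt_eqF ?andbT//; lra.
Qed.

End wedge_surface_distance.

(** * Choice of the parameters *)

Theorem proposition4p5 (R : realType) (d : nat) (hd : (3 <= d)%N) :
  exists K : convexBody R d, (theta K < Delta K)%E.
Proof.
(* The dimension is p + 2, so n = p + 1 = d - 1 is at least 2. *)
case: d hd => [|[|[|m]]]// _; set p := m.+1.
pose n : R := p.+1%:R.
have n2 : 2 <= n by rewrite ler_nat.
pose D0 := 2 * n * (2 * n + 9) * (n + 1) / ((n + 2) ^+ 2 * (2 * n + 1) * (2 * n + 3)).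
pose t0 := 2 * n / ((n + 1) * (2 * n + 1)).
pose gap := D0 - t0.
have gap0 : 0 < gap.
  (* The factor 2 n^2 - 3 is positive because n >= 2; this is where d >= 3 enters. *)
  have -> : gap = 2 * n * (2 * n ^+ 2 - 3) /
      ((n + 1) * (2 * n + 1) * (n + 2) ^+ 2 * (2 * n + 3)).
    rewrite /gap /D0 /t0; field.
    by rewrite ?gt_eqF ?andbT//; lra.
  rewrite divr_gt0//; first by rewrite mulr_gt0//; nra.
  by rewrite !mulr_gt0 ?exprn_gt0//; lra.
(* [delta] is fixed first, with n delta <= gap/4, since the constant [C] for the sides depends on
   it; [N] and [eta] are chosen afterwards. *)
pose delta := Num.min 1 (gap / (4 * n)).
have n0 : 0 < n by lra.
have delta_itv : 0 < delta <= 1.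
  by rewrite lt_min ge_min lexx ltr01/= divr_gt0// mulr_gt0.
have ndelta : n * delta <= gap / 4.
  rewrite (@le_trans _ _ (n * (gap / (4 * n))))//.
    by rewrite ler_wpM2l ?(ltW n0)// ge_min lexx orbT.
  by rewrite le_eqVlt; apply/orP; left; apply/eqP; field; rewrite gt_eqF.
pose C := 2 * n * (p.+2%:R * 2) ^+ p.+1 * (2 / delta) ^+ p.+1.
have C0 : 0 <= C.
  have /andP[/ltW d0 _] := delta_itv.
  have a0 : 0 <= 2 / delta by rewrite divr_ge0.
  by rewrite mulr_ge0 ?exprn_ge0// mulr_ge0 ?exprn_ge0// mulr_ge0// ltW.
(* With eta = 1/(4 N) the remaining errors 2 C / N and 2 n eta add up to (2 C + n/2) / N, to be made
   smaller than gap/2. *)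
have e0 : 0 < gap / 2 / (2 * C + n / 2) by rewrite divr_gt0//; lra.
have [k _ /(_ _ (leqnn _)) /= ke] := near_infty_natSinv_lt (PosNum e0).
(* This [eta] makes 2 eta N equal to 1/2, below the required 1. *)
pose N := k.+1; pose eta : R := (4 * N%:R)^-1.
have N0 : 0 < N%:R :> R by rewrite ltr0n.
have N1 : 1 <= N%:R :> R by rewrite ler1n.
have eta_itv : 0 < eta <= 1.
  apply/andP; split; first by rewrite invr_gt0 mulr_gt0.
  by rewrite invf_le1 ?mulr_gt0//; lra.
have etaN : 2 * eta * N%:R < 1.
  have -> : 2 * eta * N%:R = 2^-1 by rewrite /eta; field; rewrite gt_eqF.
  by lra.
exists (wedge_body p delta_itv eta_itv).
apply: le_lt_trans (theta_wedge_le p delta_itv eta_itv (ltn0Sn k) etaN) _.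
apply: lt_le_trans (le_Delta_wedge p delta_itv eta_itv).
rewrite lte_fin -/n -/t0 -/D0 /wedge_side_ratio -/n -/C.
have Nsmall : (2 * C + n / 2) / N%:R < gap / 2.
  by rewrite mulrC -ltr_pdivlMr//; lra.
have -> : t0 + 2 * (C / k.+1%:R) + n * (delta + 2 * eta) =
    t0 + (2 * C + n / 2) / N%:R + n * delta.
  by rewrite /eta -/N; field; rewrite gt_eqF.
have : D0 = t0 + gap by rewrite /gap; ring.
by lra.
Qed.
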